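(* Let $f\in L^2(D)$, let $u_h\in V_h$ satisfy $\int_D\kappa\nabla u_h\cdot\nabla v_h\,dx=\int_Dfv_h\,dx$ for all $v_h\in V_h$, fix $i\in\{1,\dots,N\}$, and let $u^i_{\rm snap}\in V^{H_i}_{\rm snap}$ be the element with $u^i_{\rm snap}=u_h$ on $\partial\omega_i$. For every $n\in\mathbb N_+$ with $n\le L_i$, let $u^i_n:=\mathcal P^{H_i,n}u^i_{\rm snap}=\sum_{j=1}^n(u^i_{\rm snap},v_j^{H_i})_i\,v_j^{H_i}$. Then $$\int_{\omega_i}\chi_i^2\kappa|\nabla(u^i_{\rm snap}-u^i_n)|^2dx\le4H^{-2}\int_{\omega_i}\widetilde\kappa\,(u^i_{\rm snap}-u^i_n)^2dx.$$
   Context: Setting. $D\subset\mathbb R^d$ ($d=1,2,3$) is an open bounded Lipschitz domain; $\kappa\in L^\infty(D)$ with $0<\alpha\le\kappa\le\beta$ a.e. $\mathcal T^H$ is a regular partition of $D$ into finite elements (coarse elements $K$) of mesh size $H$, with vertices $O_1,\dots,O_N$; each coarse element is partitioned further into fine elements, giving the fine mesh $\mathcal T^h$ of size $h$; $V_h\subset H^1_0(D)$ is the conforming (continuous) piecewise linear finite element space over $\mathcal T^h$. $\omega_i:=\bigcup\{K\in\mathcal T^H:O_i\in\overline K\}$. The multiscale basis function $\chi_i$ is defined on each $K$ by $-\nabla\cdot(\kappa\nabla\chi_i)=0$ in $K$, $\chi_i=g_i$ on $\partial K$, where $g_i$ is affine over (each face of) $\partial K$ with $g_i(O_j)=\delta_{ij}$;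 the paper uses that $\mathrm{supp}\,\chi_i=\omega_i$ with $\chi_i=0$ on $\partial\omega_i$. Put $\widetilde\kappa:=H^2\kappa\sum_{i=1}^N|\nabla\chi_i|^2$ and $(w_1,w_2)_i:=\int_{\omega_i}\widetilde\kappa w_1w_2\,dx$. Standing assumptions: $\|\nabla\chi_i\|_{L^\infty(\omega_i)}\le C_0<\infty$ for all $i$, and $\{\widetilde\kappa=0\}\cap D$ has measure zero. Harmonic extension space: let the fine-grid nodes on $\partial\omega_i$ be indexed by $1,\dots,L_i$, and let $\delta_j^h$ be the fine-scale piecewise linear function on $\partial\omega_i$ equal to $1$ at the $j$-th node and $0$ at the others. $\phi_j^{H_i}$ is the solution of $-\nabla\cdot(\kappa\nabla\phi_j^{H_i})=0$ in $\omega_i$, $\phi_j^{H_i}=\delta_j^h$ on $\partial\omega_i$, and $V^{H_i}_{\rm snap}:=\mathrm{span}\{\phi_j^{H_i}:1\le j\le L_i\}$. Discrete POD: with $A_{mn}=\int_{\omega_i}\kappa\nabla\phi_m^{H_i}\cdot\nabla\phi_n^{H_i}dx$, $S_{mn}=\int_{\omega_i}\widetilde\kappa\phi_m^{H_i}\phi_n^{H_i}dx$, let $(\lambda_j^{H_i},v_j)\in\mathbb R\times\mathbb R^{L_i}$, $1\le j\le L_i$, be the eigenpairs of $Av_j=\lambda_j^{H_i}Sv_j$, nondecreasing with multiplicity, $S$-orthonormal; $v_j^{H_i}:=\sum_{k=1}^{L_i}(v_j)_k\phi_k^{H_i}$. *)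

(* Defs.v *)
From HB Require Import structures.
From mathcomp Require Import all_boot all_order all_algebra.
From mathcomp Require Import all_classical all_reals all_analysis.

Set Implicit Arguments.
Unset Strict Implicit.
Unset Printing Implicit Defensive.

Import Order.TTheory GRing.Theory Num.Theory.
Import numFieldNormedType.Exports.

Local Open Scope classical_set_scope.
Local Open Scope ring_scope.

Section euclidean.
Context {R : realType} {d : nat}.
Implicit Types (x y : 'rV[R]_d) (A : set 'rV[R]_d).

Definition dot x y : R := \sum_j x 0 j * y 0 j.

(* The library norm of a row vector is the sup norm. *)
Definition enorm x : R := Num.sqrt (dot x x).

Definition diam A : R := sup [set enorm (x - y) | x in A & y in A].

Definition boundary A : set 'rV[R]_d := closure A `\` A°.

Definition partial (j : 'I_d) (f : 'rV[R]_d -> R) (x : 'rV[R]_d) : R :=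
  'D_(delta_mx 0 j) f x.

Definition grad (f : 'rV[R]_d -> R) (x : 'rV[R]_d) : 'rV[R]_d :=
  \row_j partial j f x.

Definition affine_on A (g : 'rV[R]_d -> R) : Prop :=
  exists (a : 'rV[R]_d) (b : R), forall x, A x -> g x = dot a x + b.

(* Near every boundary point, D is the strict epigraph, in some direction e, of
   a Lipschitz function gamma of the coordinates orthogonal to e. *)
Definition lipschitz_domain (D : set 'rV[R]_d) : Prop :=
  [/\ open D, bounded_set D, D !=set0, connected D &
   forall x, boundary D x ->
   exists (r : R) (e : 'rV[R]_d) (gamma : 'rV[R]_d -> R),
    [/\ 0 < r, enorm e = 1,
     exists M : R, forall y z, `|gamma y - gamma z| <= M * enorm (y - z),
     forall y (t : R), gamma (y + t *: e) = gamma y &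
     forall y, enorm (y - x) < r -> (D y <-> gamma y < dot y e)]].

End euclidean.

(* Lebesgue measure on R^(d+1): Caratheodory's construction from the volumes of
   half-open boxes. *)
Section lebesgue.
Context {R : realType} {d : nat}.
Local Notation E := 'rV[R]_d.+1.

Definition box (a b : E) : set E :=
  [set x | forall j, a 0 j < x 0 j <= b 0 j].

Definition box_volume (a b : E) : R := \prod_j (b 0 j - a 0 j).

Definition box_cover (A : set E) : set (nat -> E * E) :=
  [set B : nat -> E * E | (forall k j, (B k).1 0 j <= (B k).2 0 j) /\
           A `<=` \bigcup_k box (B k).1 (B k).2].

Definition lebesgue_outer (A : set E) : \bar R :=
  ereal_inf [set (\sum_(k <oo) (box_volume (B k).1 (B k).2)%:E)%E
            | B in box_cover A].

Let vol_ge0 A B k : box_cover A B ->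
  (0 <= (box_volume (B k).1 (B k).2)%:E)%E.
Proof.
by move=> [AB _]; rewrite lee_fin; apply: prodr_ge0 => j _; rewrite subr_ge0.
Qed.

Let outer_ge0 A : (0 <= lebesgue_outer A)%E.
Proof.
apply: le_ereal_inf_tmp => _ [B AB <-].
by apply: nneseries_ge0 => k _ _; exact: vol_ge0 AB.
Qed.

Let outer0 : lebesgue_outer set0 = 0%E.
Proof.
apply/eqP; rewrite eq_le outer_ge0 andbT.
apply: ereal_inf_lbound; exists (fun=> (0, 0)); first by split.
rewrite /= eseries0// => k _ _.
by rewrite /box_volume big_ord_recl /= subrr mul0r.
Qed.

Let le_outer : {homo lebesgue_outer : A B / A `<=` B >-> (A <= B)%E}.
Proof.
move=> A B AB; apply: ereal_inf_le_tmp => _ [C [C1 C2] <-].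
by exists C => //; split => //; exact: subset_trans C2.
Qed.

Let outer_subadditive : sigma_subadditive lebesgue_outer.
Proof.
move=> A; have [[i ioo]|] := pselect (exists i, lebesgue_outer (A i) = +oo%E).
  rewrite (eseries_pinfty _ _ ioo) ?leey// => n _.
  by rewrite -ltNye (lt_le_trans _ (outer_ge0 _)).
rewrite -forallNE => Aoo.
suff add2e (e : {posnum R}) : (lebesgue_outer (\bigcup_n A n) <=
    \sum_(i <oo) lebesgue_outer (A i) + e%:num%:E)%E.
  by apply/lee_addgt0Pr => _/posnumP[].
rewrite (le_trans _ (epsilon_trick _ _ _))//.
pose vol (p : E * E) := (box_volume p.1 p.2)%:E.
pose P n (B : nat -> E * E) := box_cover (A n) B /\
  (\sum_(k <oo) vol (B k) <=
   lebesgue_outer (A n) + (e%:num / (2 ^ n.+1)%:R)%:E)%E.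
have [G PG] : {G : nat -> nat -> E * E & forall n, P n (G n)}.
  apply: (@choice _ _ P) => n; rewrite /P /lebesgue_outer.
  set S := (X in ereal_inf X); move infS : (ereal_inf S) => iS.
  case: iS infS => [r Sr|Soo|Soo].
  - have en1 : 0 < e%:num / (2 ^ n.+1)%:R :> R by [].
    have /(lb_ereal_inf_adherent en1) : ereal_inf S \is a fin_num by rewrite Sr.
    move=> [x [B AnB muBx] xS].
    by exists B; split => //; rewrite muBx -Sr; exact/ltW.
  - by have := Aoo n; rewrite /lebesgue_outer -/S Soo.
  - by have := outer_ge0 (A n); rewrite /lebesgue_outer -/S Soo.
have volG_ge0 i j : (0 <= vol (G i j))%E by exact: vol_ge0 (PG i).1.
pose w (p : nat * nat) := vol (G p.1 p.2).
have w_ge0 p : (0 <= w p)%E by exact: volG_ge0.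
apply: (@le_trans _ _ (\esum_(i in setT) w i)%E).
  apply: ereal_inf_lbound => /=.
  have /card_esym/ppcard_eqP[f] := card_nat2.
  exists (fun k => G (f k).1 (f k).2).
    split=> [k j|t [i _ /((PG i).1.2 t)[j _ Gt]]].
      exact: (PG _).1.1.
    by exists (f^-1%FUN (i, j)) => //=; rewrite invK ?inE.
  rewrite -(esum_pred_image w f xpredT) ?[fun=> _]set_true//.
  by rewrite image_eq.
rewrite (_ : esum _ _ = \sum_(i <oo) \sum_(j <oo) vol (G i j))%E; last first.
  pose J : nat -> set (nat * nat) := fun i => [set (i, j) | j in setT].
  rewrite (_ : setT = \bigcup_k J k); last first.
    by rewrite predeqE => -[a b]; split => // _; exists a => //; exists b.
  rewrite esum_bigcupT //=; last first.
    apply/trivIsetP => i j _ _ ij.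
    rewrite predeqE => -[n m] /=; split => //= -[] [_] _ [<-{n} _].
    by move=> [m' _] [] /esym/eqP; rewrite (negbTE ij).
  rewrite -(image_id [set: nat]) -fun_true esum_pred_image//; last first.
    by move=> n _; exact: esum_ge0.
  apply: eq_eseriesr => /= j _.
  rewrite -(esum_pred_image w (pair j) predT)//=; last first.
    by move=> ? ? _ _; exact: (@can_inj _ _ _ snd).
  by congr esum; rewrite predeqE => -[a b]; split; move=> [i _ <-]; exists i.
apply: lee_lim.
- apply: is_cvg_nneseries => n *.
  by apply: nneseries_ge0 => m *; exact: volG_ge0.
- by apply: is_cvg_nneseries => n *; apply: adde_ge0.
- by near=> n; apply: lee_sum => i _; exact: (PG i).2.
Unshelve. all: by end_near. Qed.

HB.instance Definition _ := isOuterMeasure.Build R E lebesgue_outer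
  outer0 outer_ge0 le_outer outer_subadditive.

Definition lebesgue_space := caratheodory_type lebesgue_outer.

HB.instance Definition _ := Measurable.on lebesgue_space.

Definition lebesgue : set lebesgue_space -> \bar R := lebesgue_outer.

HB.instance Definition _ := isMeasure.Build _ _ _ lebesgue
  (@caratheodory_measure0 _ _ lebesgue_outer)
  (@caratheodory_measure_ge0 _ _ lebesgue_outer)
  (@caratheodory_measure_sigma_additive _ _ lebesgue_outer).

End lebesgue.

(* A Sobolev function is carried as a pair (u, weak gradient of u); only the
   values on the open set under consideration matter. Sums and multiples are the
   componentwise ones. *)
Notation sobfun R d :=
  (('rV[R]_d.+1 -> R) * ('rV[R]_d.+1 -> 'rV[R]_d.+1))%type.

Section sobolev.
Context {R : realType} {d : nat}.
Local Notation E := 'rV[R]_d.+1.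
Local Notation leb := (@lebesgue R d).
Implicit Types (U : set E) (f : E -> R) (u v w : sobfun R d).

Fixpoint Cn (n : nat) U f : Prop :=
  (forall x, U x -> {for x, continuous f}) /\
  if n is n'.+1 then
    forall j, (forall x, U x -> derivable f x (delta_mx 0 j)) /\
              Cn n' U (partial j f)
  else True.

Definition smooth U f : Prop := forall n, Cn n U f.

Definition test_function U f : Prop :=
  smooth U f /\
  exists K : set E, [/\ compact K, K `<=` U & forall x, ~ K x -> f x = 0].

Definition L2 U f : Prop :=
  measurable_fun (U : set lebesgue_space) (f : lebesgue_space -> R) /\
  (\int[leb]_(x in U) (f x ^+ 2)%:E < +oo)%E.

Definition finite_H1_norm U u : Prop :=
  L2 U u.1 /\ forall j, L2 U (fun x => u.2 x 0 j).

Definition cvg_H1 U (f : nat -> E -> R) u : Prop :=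
  ((fun n => \int[leb]_(x in U) ((f n x - u.1 x) ^+ 2)%:E)%E @ \oo --> 0%E) /\
  forall j,
   (fun n => \int[leb]_(x in U) ((partial j (f n) x - u.2 x 0 j) ^+ 2)%:E)%E
     @ \oo --> 0%E.

(* H^1(U): the completion, for the H^1 norm, of the functions of C^oo(U) with
   finite H^1 norm; by the Meyers-Serrin theorem this is W^{1,2}(U). *)
Definition H1 U u : Prop :=
  finite_H1_norm U u /\
  exists f : nat -> E -> R,
    (forall n, smooth U (f n) /\ finite_H1_norm U (f n, grad (f n))) /\
    cvg_H1 U f u.

(* H^1_0(U): the closure of C_c^oo(U) in H^1(U). *)
Definition H10 U u : Prop :=
  finite_H1_norm U u /\
  exists f : nat -> E -> R, (forall n, test_function U (f n)) /\ cvg_H1 U f u.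

(* u = g on the boundary of U, for a function g continuous on that boundary: u
   differs by an element of H^1_0(U) from a function of H^1(U) that is continuous
   up to the boundary and equal to g there. *)
Definition boundary_value U u (g : E -> R) : Prop :=
  exists w : sobfun R d,
    [/\ H1 U w, {within closure U, continuous w.1},
        forall x, boundary U x -> w.1 x = g x & H10 U (u - w)].

(* - div (kappa grad u) = 0 in U *)
Definition weakly_harmonic (kappa : E -> R) U u : Prop :=
  forall v, H10 U v ->
    \int[leb]_(x in U) (kappa x * dot (u.2 x) (v.2 x)) = 0.

Definition dirichlet_solution (kappa : E -> R) U (g : E -> R) u : Prop :=
  [/\ H1 U u, weakly_harmonic kappa U u & boundary_value U u g].

End sobolev.

Section meshes.
Context {R : realType} {d : nat}.
Local Notation E := 'rV[R]_d.+1.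
Implicit Types (s : seq E) (P F D : set E).

Definition hull s : set E :=
  [set x | exists c : 'I_(size s) -> R,
     [/\ forall k, 0 <= c k, \sum_k c k = 1 & x = \sum_k c k *: s`_k]].

(* F is cut out of P by a supporting hyperplane; with a = 0 this includes the
   empty face and P itself. *)
Definition face P F : Prop :=
  exists (a : E) (b : R), (forall x, P x -> dot a x <= b) /\
    F = P `&` [set x | dot a x = b].

(* s lists the vertices of a nondegenerate convex polytope. *)
Definition is_element s : Prop :=
  (hull s)° !=set0 /\ forall p, p \in s -> ~ hull (rem p s) p.

Definition elt s : set E := (hull s)°.

(* A regular (conforming) partition of D into the open elements elt (T k), with
   closures hull (T k). *)
Definition is_mesh D m (T : 'I_m -> seq E) : Prop :=
  [/\ forall k, is_element (T k),
      closure D = \bigcup_k hull (T k) &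
      forall k l, k != l ->
        [/\ elt (T k) `&` elt (T l) = set0,
            face (hull (T k)) (hull (T k) `&` hull (T l)) &
            face (hull (T l)) (hull (T k) `&` hull (T l))]].

Definition mesh_vertex m (T : 'I_m -> seq E) (x : E) : Prop :=
  exists k, x \in T k.

Definition mesh_size m (T : 'I_m -> seq E) : R :=
  \big[Num.max/0]_(k < m) diam (elt (T k)).

Definition refines m' (T' : 'I_m' -> seq E) m (T : 'I_m -> seq E) : Prop :=
  forall k, exists l, hull (T' k) `<=` hull (T l).

(* The interior of the union of the closed elements, so that the common faces of
   the elements around p belong to the neighborhood. *)
Definition coarse_nbhd m (T : 'I_m -> seq E) (p : E) : set E :=
  (\bigcup_(k in [set k | hull (T k) p]) hull (T k))°.

Definition fe_space D m (T : 'I_m -> seq E) : set (E -> R) :=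
  [set v | [/\ {within closure D, continuous v},
               forall k, affine_on (hull (T k)) v &
               forall x, boundary D x -> v x = 0]].

(* continuous and piecewise linear on the boundary of U, with respect to the
   faces of T that it contains *)
Definition boundary_pw_linear U m (T : 'I_m -> seq E) (g : E -> R) : Prop :=
  {within boundary U, continuous g} /\
  forall k F, face (hull (T k)) F -> F `<=` boundary U -> affine_on F g.

Definition multiscale_basis (kappa : E -> R) m (T : 'I_m -> seq E)
    N (O : 'I_N -> E) (chi : 'I_N -> sobfun R d) : Prop :=
  forall i k, exists g : E -> R,
    [/\ {within boundary (elt (T k)), continuous g},
        forall F, face (hull (T k)) F -> F `<=` boundary (elt (T k)) ->
          affine_on F g,
        forall j, boundary (elt (T k)) (O j) -> g (O j) = (i == j)%:R &
        dirichlet_solution kappa (elt (T k)) g (chi i)].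

Definition kappa_tilde (kappa : E -> R) (H : R) N (chi : 'I_N -> sobfun R d)
    (x : E) : R :=
  H ^+ 2 * kappa x * \sum_i dot ((chi i).2 x) ((chi i).2 x).

End meshes.

Section snapshots.
Context {R : realType} {d L : nat}.
Local Notation E := 'rV[R]_d.+1.
Local Notation leb := (@lebesgue R d).
Implicit Types (phi : 'I_L -> sobfun R d) (omega : set E) (kappa kt : E -> R).

Definition lin_comb phi (c : 'cV[R]_L) : sobfun R d :=
  \sum_k c k 0 *: phi k.

Definition snapshot_space phi : set (sobfun R d) := range (lin_comb phi).

Definition inner kt omega (u w : sobfun R d) : R :=
  \int[leb]_(x in omega) (kt x * u.1 x * w.1 x).

Definition stiffness kappa omega phi : 'M[R]_L :=
  \matrix_(m, n)
    \int[leb]_(x in omega) (kappa x * dot ((phi m).2 x) ((phi n).2 x)).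

Definition mass kt omega phi : 'M[R]_L :=
  \matrix_(m, n) inner kt omega (phi m) (phi n).

Definition eigenpairs (A S : 'M[R]_L) (lambda : 'I_L -> R)
    (v : 'I_L -> 'cV[R]_L) : Prop :=
  [/\ forall j, A *m v j = lambda j *: (S *m v j),
      forall j k : 'I_L, (j <= k)%N -> lambda j <= lambda k &
      forall j k, (v j)^T *m S *m v k = ((j == k)%:R)%:M].

Definition pod_projection kt omega (vH : 'I_L -> sobfun R d) (n : nat)
    (u : sobfun R d) : sobfun R d :=
  \sum_(j < L | (j < n)%N) inner kt omega u (vH j) *: vH j.

End snapshots.

(* Main.v *)
Require Import Defs.
From HB Require Import structures.
From mathcomp Require Import all_boot all_order all_algebra.
From mathcomp Require Import all_classical all_reals all_analysis.
From mathcomp Require Import measurable_realfun ring lra.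

Set Implicit Arguments.
Unset Strict Implicit.
Unset Printing Implicit Defensive.

Import Order.TTheory GRing.Theory Num.Theory.
Import numFieldNormedType.Exports.

Local Open Scope classical_set_scope.
Local Open Scope ring_scope.

(* A Caccioppoli argument. The function w := usnap - un is a combination of the
   phi j, hence kappa-harmonic in omega. Formally, testing its equation with
   chi^2 w and using Young's inequality gives
     int chi^2 kappa |grad w|^2 <= 4 int kappa |grad chi|^2 w^2,
   and H^2 kappa |grad chi i|^2 <= kt. Since chi and w are not known to be bounded,
   chi^2 w need not lie in H^1_0; one tests with s(a chi)^2 s(e w) instead, where
   s(t) = t / (1 + t^2) is smooth and bounded with bounded Lipschitz derivative,
   and recovers the inequality by Fatou's lemma as e and then a tend to 0. *)

(** The derivative of s takes negative values, so the tested energy has no sign and Fatou's lemma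
    does not apply to it directly. The remedy is to add X, the integral of s(a chi)^2 kappa |grad
    w|^2, to both sides. With Y the integral of kappa |grad (a chi)|^2 w^2, the limit in e then
    reads 2 X <= (3/2) X + 2 Y, that is X <= 4 Y. The absorption requires X to be finite, which is a
    second reason to truncate chi and not only w. Membership of the test function in H^1_0 is
    obtained by truncating the approximants of chi and w. Its gradient contains products of a merely
    convergent coefficient with an unbounded gradient, and their convergence in L^2 is the delicate
    point. Two difficulties come from the setting: the measure is built from covers by boxes, so
    measurability of open sets has to be derived from them; and [kt] involves the gradients of all
    the [chi k], which the definition of the basis controls inside single elements only, so the
    comparison with [kt] is made without measurability of [kt]. *)

(** * Mean square bounds and limits on a general measure space *)

Section square_integrable.
Context {dp : measure_display} {T : measurableType dp} {R : realType}.
Variables (mu : {measure set T -> \bar R}) (D : set T).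
Hypothesis mD : measurable D.
Implicit Types (u v w a b q : T -> R).

Definition sqint u := (\int[mu]_(x in D) (u x ^+ 2)%:E)%E.

Definition sq_integrable u := measurable_fun D u /\ (sqint u < +oo)%E.

Lemma sqint_ge0 u : (0 <= sqint u)%E.
Proof. by apply: integral_ge0 => x _; rewrite lee_fin sqr_ge0. Qed.

Lemma measurable_sqr u : measurable_fun D u ->
  measurable_fun D (EFin \o (fun x => u x ^+ 2)).
Proof. by move=> mu_; apply/measurable_EFinP; exact: measurable_funX. Qed.

Lemma sqint_eq u v : (forall x, D x -> u x = v x) -> sqint u = sqint v.
Proof. by move=> uv; apply: eq_integral => x /[!inE] Dx; rewrite uv. Qed.

Lemma sq_integrable_eq u v : (forall x, D x -> u x = v x) ->
  sq_integrable u -> sq_integrable v.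
Proof.
move=> uv [mu_ uoo]; split; last by rewrite -(sqint_eq uv).
by apply: eq_measurable_fun mu_ => x /[!inE]; exact: uv.
Qed.

(** Common source of the mean square bounds: pointwise inequalities such as (a + b)^2 <= 2 a^2 + 2
    b^2 integrate with no finiteness assumption, since the integrals are extended reals. *)
Lemma sqint_le2 (c1 c2 : R) u v w : 0 <= c1 -> 0 <= c2 ->
  measurable_fun D u -> measurable_fun D v -> measurable_fun D w ->
  (forall x, D x -> w x ^+ 2 <= c1 * u x ^+ 2 + c2 * v x ^+ 2) ->
  (sqint w <= c1%:E * sqint u + c2%:E * sqint v)%E.
Proof.
move=> c10 c20 mu_ mv mw le.
have m (c : R) (f : T -> R) : measurable_fun D f ->
    measurable_fun D (fun x => c%:E * (f x ^+ 2)%:E)%E.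
  by move=> mf; apply: measurable_funeM; exact: measurable_sqr.
have ge0 (c : R) (f : T -> R) : 0 <= c -> forall x, D x -> (0 <= c%:E * (f x ^+ 2)%:E)%E.
  by move=> c0 x _; rewrite lee_fin mulr_ge0// sqr_ge0.
have scale (c : R) (f : T -> R) : 0 <= c -> measurable_fun D f ->
    (\int[mu]_(x in D) (c%:E * (f x ^+ 2)%:E) = c%:E * sqint f)%E.
  move=> c0 mf; rewrite ge0_integralZl_EFin//; last exact: measurable_sqr.
  by move=> x _; rewrite lee_fin sqr_ge0.
rewrite -!scale// -ge0_integralD//; first last.
- exact: m.
- exact: ge0.
- exact: m.
- exact: ge0.
apply: ge0_le_integral => //.
- by move=> x _; rewrite lee_fin sqr_ge0.
- exact: measurable_sqr.
- by apply: emeasurable_funD; exact: m.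
Qed.

Lemma le_sq_integrable u v : measurable_fun D u ->
  (forall x, D x -> `|u x| <= `|v x|) -> sq_integrable v -> sq_integrable u.
Proof.
move=> mu_ uv [mv voo]; split=> //; apply: le_lt_trans voo.
apply: ge0_le_integral => //; [|exact: measurable_sqr|exact: measurable_sqr|].
  by move=> x _; rewrite lee_fin sqr_ge0.
move=> x Dx; rewrite lee_fin -[leLHS]real_normK ?num_real//.
by rewrite -[leRHS]real_normK ?num_real// lerXn2r ?nnegrE// uv.
Qed.

Lemma sqintD_le u v : measurable_fun D u -> measurable_fun D v ->
  (sqint (u \+ v)%R <= 2%:E * sqint u + 2%:E * sqint v)%E.
Proof.
move=> mu_ mv; apply: sqint_le2 => //; first exact: measurable_funD.
move=> x _ /=; have := sqr_ge0 (u x - v x); nra.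
Qed.

Lemma sqintM_le (B : R) b u : measurable_fun D b -> measurable_fun D u ->
  (forall x, D x -> `|b x| <= B) ->
  (sqint (b \* u)%R <= (B ^+ 2)%:E * sqint u)%E.
Proof.
move=> mb mu_ bB; have := @sqint_le2 (B ^+ 2) 0 u u (b \* u).
rewrite mul0e adde0; apply => //; rewrite ?sqr_ge0//.
  exact: measurable_funM.
move=> x Dx /=; rewrite mul0r addr0 exprMn ler_wpM2r ?sqr_ge0//.
by rewrite -(real_normK (num_real (b x))) lerXn2r// ?nnegrE// (le_trans _ (bB _ Dx)).
Qed.

Lemma sq_integrableD u v : sq_integrable u -> sq_integrable v ->
  sq_integrable (u \+ v).
Proof.
move=> [mu_ uoo] [mv voo]; split; first exact: measurable_funD.
apply: (le_lt_trans (sqintD_le mu_ mv)).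
by rewrite lte_add_pinfty// lte_mul_pinfty//.
Qed.

Lemma sq_integrableM (B : R) b u : measurable_fun D b ->
  (forall x, D x -> `|b x| <= B) -> sq_integrable u -> sq_integrable (b \* u).
Proof.
move=> mb bB [mu_ uoo]; split; first exact: measurable_funM.
apply: (le_lt_trans (sqintM_le mb mu_ bB)).
by rewrite lte_mul_pinfty// lee_fin sqr_ge0.
Qed.

Lemma integrable_sqr u : sq_integrable u ->
  mu.-integrable D (fun x => (u x ^+ 2)%:E).
Proof.
move=> [mu_ uoo]; apply/integrableP; split; first exact: measurable_sqr.
rewrite (eq_integral (fun x => (u x ^+ 2)%:E))// => x _.
by rewrite gee0_abs// lee_fin sqr_ge0.
Qed.

Lemma integrable_weighted_product (B : R) b u v : measurable_fun D b ->
  (forall x, D x -> `|b x| <= B) -> sq_integrable u -> sq_integrable v ->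
  mu.-integrable D (fun x => (b x * (u x * v x))%:E).
Proof.
move=> mb bB iu iv.
have : mu.-integrable D
    (fun x => B%:E * ((u x ^+ 2)%:E + (v x ^+ 2)%:E))%E.
  by apply: integrableZl => //; apply: integrableD => //; exact: integrable_sqr.
apply: le_integrable => //.
  apply/measurable_EFinP; apply: measurable_funM => //.
  by apply: measurable_funM; [case: iu|case: iv].
move=> x Dx; rewrite /= lee_fin normrM.
have B0 : 0 <= B by exact: le_trans (bB _ Dx).
rewrite (ger0_norm (mulr_ge0 B0 (addr_ge0 (sqr_ge0 _) (sqr_ge0 _)))).
apply: ler_pM => //; first exact: bB.
rewrite ler_norml; apply/andP; split.
  have := sqr_ge0 (u x + v x); have := sqr_ge0 (u x); have := sqr_ge0 (v x); nra.
have := sqr_ge0 (u x - v x); have := sqr_ge0 (u x); have := sqr_ge0 (v x); nra.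
Qed.

Lemma fatou_bound (f : nat -> T -> R) (g : T -> R) (b : \bar R) :
  (forall n, measurable_fun D (f n)) -> (forall n x, D x -> 0 <= f n x) ->
  (forall x, D x -> f n x @[n --> \oo] --> g x) ->
  (forall n, \int[mu]_(x in D) (f n x)%:E <= b)%E ->
  (\int[mu]_(x in D) (g x)%:E <= b)%E.
Proof.
move=> mf f0 fg fb.
have := @fatou _ T R mu D mD (fun n x => (f n x)%:E).
move=> /(_ (fun n => (measurable_EFinP _ _).2 (mf n))) /(_ _) fat.
have {}fat := fat (fun n x Dx => f0 n x Dx).
rewrite (_ : (\int[mu]_(x in D) (g x)%:E =
  \int[mu]_(x in D) limn_einf (fun n => (f n x)%:E))%E).
  apply: (le_trans fat); rewrite limn_einf_lim.
  apply: lime_le; first exact: is_cvg_einfs.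
  apply: nearW => n; apply: (@le_trans _ _ (\int[mu]_(x in D) (f n x)%:E)%E) => //.
  by apply: ereal_inf_lbound; exists n => /=.
apply: eq_integral => x /[!inE] Dx.
have /cvg_limn_einf_sup[-> //] : (f n x)%:E @[n --> \oo] --> (g x)%:E.
by apply: cvg_EFin; [exact: nearW|exact: fg].
Qed.

Lemma cvge0P (f : nat -> \bar R) : (forall n, 0 <= f n)%E ->
  f @ \oo --> 0%E <->
  forall e : R, 0 < e -> \forall n \near \oo, (f n <= e%:E)%E.
Proof.
move=> f0; split=> [/fine_cvgP[fin /cvgrPdist_le cf] e e0|H].
  near=> n; have ffin : f n \is a fin_num by near: n.
  rewrite -(fineK ffin) lee_fin (le_trans (ler_norm _))//.
  by rewrite -normrN -[- _]add0r; near: n; exact: cf.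
apply/fine_cvgP; split.
  near=> n; rewrite ge0_fin_numE//; apply: (@le_lt_trans _ _ 1%:E).
    by near: n; exact: H.
  by rewrite ltry.
apply/cvgrPdist_le => e e0; near=> n; rewrite sub0r normrN ger0_norm ?fine_ge0//.
have fe : (f n <= e%:E)%E by near: n; exact: H.
rewrite -lee_fin fineK// ge0_fin_numE//; apply: (le_lt_trans fe).
by rewrite ltry.
Unshelve. all: by end_near. Qed.

Lemma cvge0_le2 (f g h : nat -> \bar R) (c1 c2 : R) :
  (forall n, 0 <= f n)%E -> (forall n, f n <= c1%:E * g n + c2%:E * h n)%E ->
  g @ \oo --> 0%E -> h @ \oo --> 0%E -> f @ \oo --> 0%E.
Proof.
move=> f0 fle g0 h0; apply: (@squeeze_cvge _ _ _ _ (cst 0%E) _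
    (fun n => c1%:E * g n + c2%:E * h n)%E).
- by apply: nearW => n; rewrite f0 fle.
- exact: cvg_cst.
- have /(cvgeZl (y := c1%:E) isT) := g0; rewrite mule0 => cg.
  have /(cvgeZl (y := c2%:E) isT) := h0; rewrite mule0 => ch.
  by rewrite -[0%E]adde0; exact: cvgeD cg ch.
Qed.

Lemma measurable_excess q (k : R) : measurable_fun D q ->
  measurable_fun D (fun x => Num.max (`|q x| - k) 0).
Proof.
move=> mq; apply: measurable_maxr => //; apply: measurable_funB => //.
exact: measurableT_comp.
Qed.

(** Dominated convergence with majorant q^2: at each point the excess is 0 as soon as k >= |q x|. *)
Lemma cvg_sqint_excess q : sq_integrable q ->
  (fun k => sqint (fun x => Num.max (`|q x| - k%:R) 0)) @ \oo --> 0%E.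
Proof.
move=> iq; have [mq _] := iq.
have := @dominated_convergence _ T R mu D mD
  (fun k x => (Num.max (`|q x| - k%:R) 0 ^+ 2)%:E) (cst 0%E)
  (fun x => (q x ^+ 2)%:E).
case=> //.
- by move=> k; apply: measurable_sqr; exact: measurable_excess.
- apply: aeW => x Dx; apply: cvg_EFin; first exact: nearW.
  apply: cvg_near_cst; near=> k; rewrite /= max_r ?expr0n// subr_le0.
  by near: k; exact: nbhs_infty_ger.
- exact: integrable_sqr.
- apply: aeW => x k Dx; rewrite /= lee_fin ger0_norm ?sqr_ge0//.
  rewrite -[leRHS](real_normK (num_real (q x))) lerXn2r ?nnegrE//.
  by rewrite ge_max normr_ge0 andbT lerBlDr lerDl.
- by move=> _ _; rewrite integral_cst// mul0e.
Unshelve. all: by end_near. Qed.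

(* The factor [q] is fixed, so it can be truncated at a level [k]: below [k] use
   [|b| <= C |a|], above [k] use [|b| <= B] and let [k] grow. *)
Lemma cvg_sqintM (a b : nat -> T -> R) q (B C : R) : 0 <= B -> 0 <= C ->
  (forall n, measurable_fun D (a n)) -> (forall n, measurable_fun D (b n)) ->
  sq_integrable q ->
  (forall n x, D x -> `|b n x| <= B) ->
  (forall n x, D x -> `|b n x| <= C * `|a n x|) ->
  (fun n => sqint (a n)) @ \oo --> 0%E ->
  (fun n => sqint (b n \* q)) @ \oo --> 0%E.
Proof.
move=> B0 C0 ma mb iq bB ba a0; have [mq _] := iq.
pose t k x := Num.max (`|q x| - k%:R) 0.
have bnd k n : (sqint (b n \* q)%R <= (2 * (C * k%:R) ^+ 2)%:E * sqint (a n) +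
                            (2 * B ^+ 2)%:E * sqint (t k))%E.
  apply: sqint_le2 => //.
  - by rewrite mulr_ge0// sqr_ge0.
  - by rewrite mulr_ge0// sqr_ge0.
  - exact: measurable_excess.
  - exact: measurable_funM.
  move=> x Dx /=.
  have qt : `|q x| <= k%:R + t k x by rewrite -lerBlDl le_max lexx.
  have t0 : 0 <= t k x by rewrite le_max lexx orbT.
  have le1 : `|b n x * q x| <= C * k%:R * `|a n x| + B * t k x.
    rewrite normrM (le_trans (ler_wpM2l _ qt))// mulrDr lerD//.
      by rewrite mulrAC ler_wpM2r// ba.
    by rewrite ler_wpM2r// bB.
  rewrite -(real_normK (num_real (b n x * q x))).
  apply: (@le_trans _ _ ((C * k%:R * `|a n x| + B * t k x) ^+ 2)).
    rewrite lerXn2r ?nnegrE// addr_ge0// mulr_ge0// mulr_ge0//.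
  rewrite -(real_normK (num_real (a n x))).
  have := sqr_ge0 (C * k%:R * `|a n x| - B * t k x); nra.
apply/cvge0P => [n|e e0]; first exact: sqint_ge0.
have e20 : 0 < e / 2 by rewrite divr_gt0.
have c0 : 0 < 2 * B ^+ 2 + 1 by rewrite ltr_wpDl// mulr_ge0// sqr_ge0.
have [k _ /(_ k (leqnn k)) tk] :=
  (cvge0P (fun k => sqint_ge0 (t k))).1 (cvg_sqint_excess iq) _ (divr_gt0 e20 c0).
have c'0 : 0 < 2 * (C * k%:R) ^+ 2 + 1 by rewrite ltr_wpDl// mulr_ge0// sqr_ge0.
near=> n; apply: (le_trans (bnd k n)).
have an : (sqint (a n) <= (e / 2 / (2 * (C * k%:R) ^+ 2 + 1))%:E)%E.
  near: n; apply: (cvge0P (fun n => sqint_ge0 (a n))).1 => //.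
  exact: divr_gt0.
have frac (c s : R) : 0 <= c -> 0 < s -> c * (s / (c + 1)) <= s.
  move=> c_ge0 s0; rewrite mulrCA ger_pMr// ler_pdivrMr ?mul1r ?lerDl//.
  by rewrite ltr_wpDl.
rewrite [e in leRHS]splitr EFinD; apply: leeD.
  apply: (le_trans (lee_wpmul2l _ an)); first by rewrite lee_fin mulr_ge0// sqr_ge0.
  by rewrite -EFinM lee_fin frac// mulr_ge0// sqr_ge0.
apply: (le_trans (lee_wpmul2l _ tk)); first by rewrite lee_fin mulr_ge0// sqr_ge0.
by rewrite -EFinM lee_fin frac// mulr_ge0// sqr_ge0.
Unshelve. all: by end_near. Qed.

End square_integrable.

(** * Open sets are measurable for the Caratheodory measure *)

Section lebesgue_borel.
Context {R : realType} {d : nat}.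
Local Notation E := 'rV[R]_d.+1.
Local Notation leb := (@lebesgue R d).
Implicit Types (a b : E) (A U : set E) (B : nat -> E * E).

(** Projection of the cutting height [c] onto the [j]-th side of the box. When [c] misses the box,
    one of the two parts degenerates but still has ordered corners, as [box_cover] demands. *)
Definition clamp (j : 'I_d.+1) (c : R) (p : E * E) : R :=
  Num.max (p.1 0 j) (Num.min (p.2 0 j) c).

Definition lower_part (j : 'I_d.+1) (c : R) (p : E * E) : E * E :=
  (p.1, \row_k if k == j then clamp j c p else p.2 0 k).

Definition upper_part (j : 'I_d.+1) (c : R) (p : E * E) : E * E :=
  (\row_k (if k == j then clamp j c p else p.1 0 k), p.2).

Lemma box_volume_parts (j : 'I_d.+1) (c : R) (p : E * E) :
  box_volume (lower_part j c p).1 (lower_part j c p).2 +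
  box_volume (upper_part j c p).1 (upper_part j c p).2 = box_volume p.1 p.2.
Proof.
rewrite /box_volume !(bigD1 (P := xpredT) j)//= !mxE eqxx.
rewrite (eq_bigr (fun k => p.2 0 k - p.1 0 k)); last first.
  by move=> k kj; rewrite mxE (negbTE kj).
rewrite [in X in _ + X = _](eq_bigr (fun k => p.2 0 k - p.1 0 k)); last first.
  by move=> k kj; rewrite mxE (negbTE kj).
by rewrite -mulrDl; congr (_ * _); ring.
Qed.

(** Cutting every box of a cover of [A] at height [c] yields a cover of the part of [A] in the
    half-space and one of the part outside, and the volumes add up exactly. The boxes being
    half-open, the lower parts catch the points with x_j <= c and the upper parts those with x_j >
    c. *)
Lemma halfspace_measurable (j : 'I_d.+1) (c : R) :
  measurable ([set x : E | x 0 j <= c] : set (@lebesgue_space R d)).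
Proof.
set Hc := [set x : E | _].
apply: (@le_caratheodory_measurable R E (@lebesgue_outer R d) Hc) => A.
apply: le_ereal_inf_tmp => _ [B AB <-]; have [leB coverA] := AB.
have clampP k : (B k).1 0 j <= clamp j c (B k) <= (B k).2 0 j.
  rewrite /clamp le_max lexx/= ge_max leB/=.
  by rewrite ge_min lexx.
pose BL k := lower_part j c (B k); pose BU k := upper_part j c (B k).
have AL : box_cover (A `&` Hc) BL.
  split=> [k l|x [Ax Hx]].
    by rewrite mxE; case: eqP => [->|_]; [case/andP: (clampP k)|exact: leB].
  have [k _ bx] := coverA _ Ax; exists k => // l; rewrite mxE.
  have /andP[al bl] := bx l; rewrite al/=; case: eqP => // lj; subst l.
  by rewrite le_max le_min bl Hx orbT.
have AU : box_cover (A `&` ~` Hc) BU.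
  split=> [k l|x [Ax /negP]].
    by rewrite mxE; case: eqP => [->|_]; [case/andP: (clampP k)|exact: leB].
  rewrite -ltNge => Hx.
  have [k _ bx] := coverA _ Ax; exists k => // l; rewrite mxE.
  have /andP[al bl] := bx l; rewrite bl andbT; case: eqP => // lj; subst l.
  by rewrite gt_max al/= gt_min Hx orbT.
have vol_ge0 C (A' : set E) k : box_cover A' C ->
    (0 <= (box_volume (C k).1 (C k).2)%:E)%E.
  by move=> [leC _]; rewrite lee_fin prodr_ge0// => l _; rewrite subr_ge0.
rewrite (eq_eseriesr (g := fun k => ((box_volume (BL k).1 (BL k).2)%:E +
    (box_volume (BU k).1 (BU k).2)%:E)%E)); last first.
  by move=> k _; rewrite -EFinD box_volume_parts.
rewrite nneseriesD//; [|by move=> *; exact: vol_ge0 AL|by move=> *; exact: vol_ge0 AU].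
by apply: leeD; apply: ereal_inf_lbound; [exists BL|exists BU].
Qed.

Lemma box_measurable a b : measurable (box a b : set (@lebesgue_space R d)).
Proof.
have -> : box a b = \bigcap_(j in [set: 'I_d.+1])
    ([set x : E | x 0 j <= b 0 j] `&` ~` [set x : E | x 0 j <= a 0 j]).
  apply/seteqP; split=> x /= xab j.
    by move=> _; have /andP[aj bj] := xab j; split => //; apply/negP; rewrite -ltNge.
  by have [bj /negP] := xab j I; rewrite -ltNge => ->.
apply: fin_bigcap_measurable => // j _.
by apply: measurableI; last apply: measurableC; exact: halfspace_measurable.
Qed.

(** The boxes with rational corners contained in [U] cover it and are countably many. Boxes not
    contained in [U] are replaced by the empty set, so that the union runs over a countable type. *)
Lemma open_lebesgue_measurable U : open U ->
  measurable (U : set (@lebesgue_space R d)).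
Proof.
move=> oU.
pose rbox (p : 'rV[rat]_d.+1 * 'rV[rat]_d.+1) : set E :=
  box (map_mx ratr p.1) (map_mx ratr p.2).
pose F p : set (@lebesgue_space R d) := if `[< rbox p `<=` U >] then rbox p else set0.
have -> : U = \bigcup_p F p.
  apply/seteqP; split=> [x Ux|x [p _]]; last first.
    by rewrite /F; case: asboolP => // pU; exact: pU.
  have /nbhs_ballP[e /= e0 xe] : nbhs x U by move: oU; rewrite openE; exact.
  have /choice[a ax] (j : 'I_d.+1) : exists q : rat, x 0 j - e < ratr q < x 0 j.
    have /rat_in_itvoo[q] : x 0 j - e < x 0 j by rewrite gtrDl oppr_lt0.
    by rewrite in_itv/=; exists q.
  have /choice[b xb] (j : 'I_d.+1) : exists q : rat, x 0 j < ratr q < x 0 j + e.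
    have /rat_in_itvoo[q] : x 0 j < x 0 j + e by rewrite ltrDl.
    by rewrite in_itv/=; exists q.
  exists (\row_j a j, \row_j b j) => //; rewrite /F; case: asboolP => [_ j|[]].
    by rewrite !mxE; have /andP[_ ->] := ax j; have /andP[/ltW -> _] := xb j.
  move=> y xy; apply: xe; split => // i j; rewrite ord1 /ball/= ltr_distlC.
  have := xy j; rewrite !mxE => /andP[ay yb].
  have /andP[xa _] := ax j; have /andP[_ bx] := xb j.
  by rewrite (lt_trans xa ay) (le_lt_trans yb bx).
apply: countable_bigcupT_measurable => [|p]; first exact: countableP.
by rewrite /F; case: ifP => _ //; exact: box_measurable.
Qed.

Lemma continuous_lebesgue_measurable U (f : E -> R) : open U ->
  (forall x, U x -> {for x, continuous f}) ->
  measurable_fun (U : set (@lebesgue_space R d)) f.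
Proof.
move=> oU cf; apply: (measurability _ (RGenOInfty.measurableE R)).
move=> _ [_ [c ->] <-]; apply: open_lebesgue_measurable.
rewrite openE => x [Ux cx]; apply: filterI.
  by move: oU; rewrite openE; exact.
apply: (cf _ Ux); apply: open_nbhs_nbhs; split => //.
Qed.

End lebesgue_borel.

(** * Sums, products and inverses of smooth functions *)

Section smooth_functions.
Context {R : realType} {d : nat}.
Local Notation E := 'rV[R]_d.+1.
Implicit Types (U : set E) (f g : E -> R).

Lemma open_near U x : open U -> U x -> \forall y \near x, U y.
Proof. by move=> + Ux; rewrite openE; exact. Qed.

(** Derivatives at a point of an open set see only nearby values. The rules for derivatives of sums,
    products and inverses hold only at points of [U], so each induction step below replaces a
    partial derivative by a formula that agrees with it on [U] alone. *)
Lemma Cn_ext n U f g : open U -> (forall x, U x -> f x = g x) ->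
  Cn n U f -> Cn n U g.
Proof.
move=> oU; have cont_ext h k x : (forall y, U y -> h y = k y) -> U x ->
    {for x, continuous h} -> {for x, continuous (k : E -> R)}.
  move=> hk Ux; rewrite /prop_for /continuous_at (hk _ Ux) => ch.
  apply: (cvg_trans _ ch); apply: (near_eq_cvg (F := nbhs x)).
  by apply: filterS (open_near oU Ux) => y; exact: hk.
elim: n f g => [|n IH] f g fg [cf Hf].
  by split=> // x Ux; exact: cont_ext (cf _ Ux).
split=> [x Ux|j]; first exact: cont_ext (cf _ Ux).
have [df Cf] := Hf j; split=> [x Ux|].
  by apply: near_eq_derivable (df _ Ux); apply: filterS (open_near oU Ux) => y; exact: fg.
apply: IH Cf => x Ux; apply: near_eq_derive.
by apply: filterS (open_near oU Ux) => y; exact: fg.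
Qed.

Lemma Cn_cont n U f x : Cn n U f -> U x -> {for x, continuous f}.
Proof. by case: n => [|n] [cf _]; exact: cf. Qed.

Lemma CnW n U f : Cn n.+1 U f -> Cn n U f.
Proof.
elim: n f => [|n IH] f [cf Hf]; split=> // j.
by have [df /IH Cf] := Hf j.
Qed.

Lemma Cn_derivable n U f j x : Cn n.+1 U f -> U x ->
  derivable f x (delta_mx 0 j).
Proof. by move=> [_ /(_ j)[df _]]; exact: df. Qed.

Lemma Cn_cst n U (c : R) : Cn n U (cst c).
Proof.
elim: n c => [|n IH] c; first by split=> [x _|]; [exact: cst_continuous|].
split=> [x _|j]; first exact: cst_continuous.
split=> [x _|]; first exact: derivable_cst.
by have -> : partial j (cst c : E -> R) = cst 0
  by apply/funext => x; exact: derive_cst.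
Qed.

Lemma CnD n U f g : open U -> Cn n U f -> Cn n U g -> Cn n U (f \+ g).
Proof.
move=> oU; elim: n f g => [|n IH] f g Cf Cg.
  split=> [x Ux|]; last by []; apply: continuousD; [exact: (Cn_cont Cf Ux)|exact: (Cn_cont Cg Ux)].
split=> [x Ux|j]; first by apply: continuousD; [exact: (Cn_cont Cf Ux)|exact: (Cn_cont Cg Ux)].
split=> [x Ux|].
  by exact: (derivableD (Cn_derivable Cf Ux) (Cn_derivable Cg Ux)).
apply: (@Cn_ext _ _ (partial j f \+ partial j g)) => // [x Ux|].
  by exact/esym/(deriveD (Cn_derivable Cf Ux) (Cn_derivable Cg Ux)).
by apply: IH; [case: Cf => _ /(_ j)[]|case: Cg => _ /(_ j)[]].
Qed.

Lemma CnM n U f g : open U -> Cn n U f -> Cn n U g -> Cn n U (f \* g).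
Proof.
move=> oU; elim: n f g => [|n IH] f g Cf Cg.
  split=> [x Ux|]; last by []; apply: continuousM; [exact: (Cn_cont Cf Ux)|exact: (Cn_cont Cg Ux)].
split=> [x Ux|j]; first by apply: continuousM; [exact: (Cn_cont Cf Ux)|exact: (Cn_cont Cg Ux)].
split=> [x Ux|].
  by exact: (derivableM (Cn_derivable Cf Ux) (Cn_derivable Cg Ux)).
apply: (@Cn_ext _ _ ((f \* partial j g) \+ (g \* partial j f))) => // [x Ux|].
  by exact/esym/(deriveM (Cn_derivable Cf Ux) (Cn_derivable Cg Ux)).
by apply: CnD => //; apply: IH; rewrite ?CnW//;
  try exact: CnW; [case: Cg => _ /(_ j)[]|case: Cf => _ /(_ j)[]].
Qed.

Lemma CnV n U f : open U -> (forall x, U x -> f x != 0) -> Cn n U f ->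
  Cn n U (fun x => (f x)^-1).
Proof.
move=> oU f0; elim: n => [|n IH] Cf.
  by split=> [x Ux|]; last by []; apply: continuousV; [exact: f0|exact: (Cn_cont Cf Ux)].
split=> [x Ux|j]; first by apply: continuousV; [exact: f0|exact: (Cn_cont Cf Ux)].
have CV := IH (CnW Cf); split=> [x Ux|].
  by apply: derivableV; [exact: f0|exact: (Cn_derivable Cf Ux)].
(* The factor -f^(-2) is written with two copies of 1/f, to which the induction hypothesis
   applies. *)
apply: (@Cn_ext _ _ ((cst (-1) \* ((fun x => (f x)^-1) \* (fun x => (f x)^-1)))
    \* partial j f)) => // [x Ux|].
  rewrite /partial deriveV ?f0//; last exact: (Cn_derivable Cf Ux).
  by rewrite /= mulN1r -invfM.
apply: CnM => //; last by case: Cf => _ /(_ j)[].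
by apply: CnM => //; [exact: Cn_cst|exact: CnM].
Qed.

Lemma smoothD U f g : open U -> smooth U f -> smooth U g -> smooth U (f \+ g).
Proof. by move=> oU Cf Cg n; exact: CnD. Qed.

Lemma smoothM U f g : open U -> smooth U f -> smooth U g -> smooth U (f \* g).
Proof. by move=> oU Cf Cg n; exact: CnM. Qed.

Lemma smooth_cst U (c : R) : smooth U (cst c).
Proof. by move=> n; exact: Cn_cst. Qed.

Lemma smoothV U f : open U -> (forall x, U x -> f x != 0) -> smooth U f ->
  smooth U (fun x => (f x)^-1).
Proof. by move=> oU f0 Cf n; exact: CnV. Qed.

Lemma smooth_cont U f x : smooth U f -> U x -> {for x, continuous f}.
Proof. by move=> /(_ 0%N); exact: Cn_cont. Qed.

Lemma smooth_derivable U f j x : smooth U f -> U x ->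
  derivable f x (delta_mx 0 j).
Proof. by move=> /(_ 1%N); exact: Cn_derivable. Qed.

Lemma smooth_partial U f j : smooth U f -> smooth U (partial j f).
Proof. by move=> Cf n; have [_ /(_ j)[]] := Cf n.+1. Qed.

End smooth_functions.

(** * The truncation t / (1 + t^2) and its smoothness *)

Section truncation.
Context {R : realType}.
Implicit Types s t : R.

Definition damp t : R := (1 + t ^+ 2)^-1.

Definition trunc t : R := t * damp t.

(** The derivative (1 - t^2) / (1 + t^2)^2 of [trunc], in a form whose bounds follow from those of
    [damp] and [trunc]. *)
Definition dtrunc t : R := damp t ^+ 2 - trunc t ^+ 2.

Let den_gt0 t : 0 < 1 + t ^+ 2.
Proof. by rewrite ltr_wpDr// sqr_ge0. Qed.

Lemma dampE t : (1 + t ^+ 2) * damp t = 1.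
Proof. by rewrite /damp mulfV// gt_eqF. Qed.

Lemma damp_gt0 t : 0 < damp t.
Proof. by rewrite invr_gt0. Qed.

(** The point (damp t, trunc t) runs on the circle of centre (1/2, 0) and radius 1/2. The bounds on
    [damp], [trunc] and [dtrunc] rest on this identity. *)
Lemma damp_truncE t : damp t ^+ 2 + trunc t ^+ 2 = damp t.
Proof. by have := dampE t; rewrite /trunc => e; rewrite -[RHS]mul1r -e; ring. Qed.

Lemma damp_le1 t : damp t <= 1.
Proof. by have := damp_truncE t; have := sqr_ge0 (trunc t); nra. Qed.

Lemma norm_damp t : `|damp t| <= 1.
Proof. by rewrite ger0_norm ?damp_le1// ltW// damp_gt0. Qed.

Lemma norm_trunc t : `|trunc t| <= 1.
Proof.
rewrite -(@expr_le1 _ 2%N)// real_normK ?num_real//.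
by have := damp_truncE t; have := damp_le1 t; have := sqr_ge0 (damp t); nra.
Qed.

Lemma norm_trunc_le t : `|trunc t| <= `|t|.
Proof. by rewrite normrM ler_piMr// norm_damp. Qed.

Lemma norm_dtrunc t : `|dtrunc t| <= 1.
Proof.
rewrite ler_norml /dtrunc; have := damp_truncE t; have := damp_le1 t.
have := sqr_ge0 (damp t); have := sqr_ge0 (trunc t) => *; apply/andP; split; nra.
Qed.

Lemma damp_lip s t : `|damp s - damp t| <= `|s - t|.
Proof.
(* Each of the two terms is multiplied by 1 = (1 + x^2) damp x at the other point; the difference
   then contains t^2 - s^2, hence the factor s - t. *)
have -> : damp s - damp t = - (trunc s * damp t + damp s * trunc t) * (s - t).
  rewrite -[damp s]mul1r -[1 in LHS](dampE t) -[damp t in X in _ - X]mul1r.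
  by rewrite -[1 in X in _ - X](dampE s) /trunc; ring.
rewrite normrM ler_piMl// normrN.
rewrite (le_trans (ler_normD _ _))// (normrM (trunc s)) (normrM (damp s)).
have ds := damp_gt0 s; have dt := damp_gt0 t.
rewrite (ger0_norm (ltW ds)) (ger0_norm (ltW dt)).
(* The radius of the circle: trunc^2 = damp - damp^2 <= 1/4. Two such halves give the Lipschitz
   constant 1. *)
have half u : `|trunc u| <= 1 / 2.
  rewrite -(@ler_pXn2r _ 2%N)// ?nnegrE ?divr_ge0//.
  rewrite real_normK ?num_real//.
  by have := damp_truncE u; have := sqr_ge0 (damp u - 1 / 2); nra.
rewrite [leRHS](splitr 1) lerD//.
  by rewrite -[leRHS]mulr1 ler_pM ?half ?damp_le1 // ltW.
by rewrite -[leRHS]mul1r ler_pM ?half ?damp_le1 // ltW.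
Qed.

Lemma trunc_lip s t : `|trunc s - trunc t| <= 2 * `|s - t|.
Proof.
have -> : trunc s - trunc t = (damp s * damp t - trunc s * trunc t) * (s - t).
  rewrite /trunc -[s * _]mulr1 -[1 in LHS](dampE t).
  by rewrite -[t * _ in X in _ - X]mulr1 -[1 in X in _ - X](dampE s); ring.
rewrite normrM ler_wpM2r// (le_trans (ler_normB _ _))//.
rewrite (normrM (damp s)) (normrM (trunc s)).
by rewrite -[leRHS]/(1 + 1) lerD// -[leRHS]mulr1 ler_pM ?norm_damp ?norm_trunc.
Qed.

Lemma continuous_damp : continuous damp.
Proof.
move=> t; apply: cvgV; first by rewrite gt_eqF.
by apply: cvgD; [exact: cvg_cst|exact: exprn_continuous].
Qed.

Lemma continuous_trunc : continuous trunc.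
Proof. by move=> t; apply: cvgM; [exact: cvg_id|exact: continuous_damp]. Qed.

Lemma continuous_dtrunc : continuous dtrunc.
Proof.
move=> t; apply: cvgB.
  exact: (cvg_comp _ _ (@continuous_damp t) (@exprn_continuous _ 2%N _)).
exact: (cvg_comp _ _ (@continuous_trunc t) (@exprn_continuous _ 2%N _)).
Qed.

Lemma damp0 : damp 0 = 1.
Proof. by rewrite /damp expr0n/= addr0 invr1. Qed.

Lemma trunc0 : trunc 0 = 0.
Proof. by rewrite /trunc mul0r. Qed.

Lemma dtrunc0 : dtrunc 0 = 1.
Proof. by rewrite /dtrunc damp0 trunc0 expr1n expr0n subr0. Qed.

End truncation.

Section truncation_of_smooth_functions.
Context {R : realType} {d : nat}.
Local Notation E := 'rV[R]_d.+1.
Implicit Types (U : set E) (f g : E -> R).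

Let den_neq0 (t : R) : 1 + t * t != 0.
Proof. by rewrite gt_eqF// ltr_wpDr// -expr2 sqr_ge0. Qed.

Lemma damp_comp f : damp \o f = (fun x => ((cst 1 \+ f \* f) x)^-1).
Proof. by apply/funext => x; rewrite /= /damp expr2. Qed.

(** As [trunc] is a rational function with a denominator that never vanishes, sums, products and
    inverses suffice; no chain rule for higher derivatives enters. *)
Lemma smooth_trunc U f : open U -> smooth U f -> smooth U (trunc \o f).
Proof.
move=> oU sf; rewrite (_ : trunc \o f = f \* (damp \o f))//.
apply: smoothM => //; rewrite damp_comp; apply: (smoothV (f := cst 1 \+ f \* f)) => // [x _|].
  exact: den_neq0.
by apply: smoothD => //; [exact: smooth_cst|exact: smoothM].
Qed.

Lemma is_derive_trunc f (x v : E) (df : R) : is_derive x v f df ->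
  is_derive x v (trunc \o f) (dtrunc (f x) * df).
Proof.
move=> [fxv fdf].
have dc : derivable (cst 1 : E -> R) x v by exact: derivable_cst.
have dff := derivableM fxv fxv; have eff := deriveM fxv fxv.
have dden := derivableD dc dff; have eden := deriveD dc dff.
rewrite eff derive_cst fdf add0r in eden.
have den0 : (cst 1 + f * f) x != 0 by exact: den_neq0.
have dV := derivableV den0 dden; have eV := deriveV den0 dden.
have -> : trunc \o f = f * (fun y => ((cst 1 + f * f) y)^-1).
  by apply/funext => y; rewrite /= /trunc /damp expr2.
apply: (DeriveDef (derivableM fxv dV)).
rewrite (deriveM fxv dV) eV eden fdf.
have -> : (cst 1 + f * f) x = (damp (f x))^-1 by rewrite /damp invrK expr2.
rewrite exprVn !invrK.
transitivity (f x * (- damp (f x) ^+ 2 * (f x * df + f x * df)) + damp (f x) * df) => //.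
have e := dampE (f x).
rewrite /dtrunc /trunc -[damp (f x) in X in _ + X]mul1r.
rewrite -[1 in X in _ + X]e; ring.
Qed.

End truncation_of_smooth_functions.

(** What composition needs in the limits below: continuity makes [F \o u] measurable, the Lipschitz
    constant carries mean square convergence over, and the bound keeps products with square
    integrable functions square integrable. *)
Definition bounded_lipschitz {R : realType} (F : R -> R) : Prop :=
  [/\ continuous F, exists B : R, forall t, `|F t| <= B &
      exists C : R, forall s t, `|F s - F t| <= C * `|s - t|].

Section bounded_lipschitz_functions.
Context {R : realType}.
Implicit Types F G : R -> R.

Lemma bounded_lipschitz_bound F : bounded_lipschitz F ->
  exists2 B : R, 0 <= B & forall t, `|F t| <= B.
Proof. by move=> [_ [B FB] _]; exists B; last exact: FB; exact: le_trans (normr_ge0 _) (FB 0). Qed.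

Lemma bounded_lipschitz_const F : bounded_lipschitz F ->
  exists2 C : R, 0 <= C & forall s t, `|F s - F t| <= C * `|s - t|.
Proof.
move=> [_ _ [C FC]]; exists C; last exact: FC.
by have := FC 1 0; rewrite subr0 normr1 mulr1; exact: le_trans.
Qed.

Lemma bounded_lipschitzM F G : bounded_lipschitz F -> bounded_lipschitz G ->
  bounded_lipschitz (F \* G).
Proof.
move=> FF GG; have [B B0 FB] := bounded_lipschitz_bound FF.
have [B' B'0 GB] := bounded_lipschitz_bound GG.
have [C C0 FC] := bounded_lipschitz_const FF.
have [C' C'0 GC] := bounded_lipschitz_const GG.
split.
- have [cF _ _] := FF; have [cG _ _] := GG.
  by move=> t; apply: continuousM; [exact: cF|exact: cG].
- by exists (B * B') => t; rewrite /= normrM ler_pM.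
- exists (B * C' + B' * C) => s t /=.
  have -> : F s * G s - F t * G t = F s * (G s - G t) + G t * (F s - F t) by ring.
  rewrite (le_trans (ler_normD _ _))// !normrM mulrDl -!mulrA lerD//.
    by apply: ler_pM.
  by apply: ler_pM.
Qed.

Lemma bounded_lipschitzB F G : bounded_lipschitz F -> bounded_lipschitz G ->
  bounded_lipschitz (F \- G).
Proof.
move=> [cF [B FB] [C FC]] [cG [B' GB] [C' GC]]; split.
- by move=> t; apply: continuousB; [exact: cF|exact: cG].
- by exists (B + B') => t; rewrite /= (le_trans (ler_normB _ _))// lerD.
- exists (C + C') => s t /=.
  have -> : F s - G s - (F t - G t) = (F s - F t) - (G s - G t) by ring.
  by rewrite (le_trans (ler_normB _ _))// mulrDl lerD.
Qed.

Lemma bounded_lipschitz_cst (c : R) : bounded_lipschitz (cst c).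
Proof.
split; first exact: cst_continuous.
  by exists `|c|.
by exists 0 => s t; rewrite subrr normr0 mul0r.
Qed.

Lemma bounded_lipschitz_damp : bounded_lipschitz (@damp R).
Proof.
split; first exact: continuous_damp.
  by exists 1; exact: norm_damp.
by exists 1 => s t; rewrite mul1r; exact: damp_lip.
Qed.

Lemma bounded_lipschitz_trunc : bounded_lipschitz (@trunc R).
Proof.
split; first exact: continuous_trunc.
  by exists 1; exact: norm_trunc.
by exists 2 => s t; exact: trunc_lip.
Qed.

Lemma bounded_lipschitz_dtrunc : bounded_lipschitz (@dtrunc R).
Proof.
rewrite (_ : dtrunc = (damp \* damp) \- (trunc \* trunc)).
  by apply: bounded_lipschitzB; apply: bounded_lipschitzM;
    first [exact: bounded_lipschitz_damp|exact: bounded_lipschitz_trunc].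
by apply/funext => t; rewrite /dtrunc /= !expr2.
Qed.

Definition sqtrunc (t : R) := trunc t ^+ 2.

Definition dsqtrunc (t : R) := 2 * trunc t * dtrunc t.

Lemma bounded_lipschitz_sqtrunc : bounded_lipschitz sqtrunc.
Proof.
rewrite (_ : sqtrunc = trunc \* trunc); last by apply/funext => t; rewrite /sqtrunc expr2.
by apply: bounded_lipschitzM; exact: bounded_lipschitz_trunc.
Qed.

Lemma bounded_lipschitz_dsqtrunc : bounded_lipschitz dsqtrunc.
Proof.
rewrite (_ : dsqtrunc = (cst 2 \* trunc) \* dtrunc)//.
apply: bounded_lipschitzM; last exact: bounded_lipschitz_dtrunc.
by apply: bounded_lipschitzM; [exact: bounded_lipschitz_cst|exact: bounded_lipschitz_trunc].
Qed.

End bounded_lipschitz_functions.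

(** * Mean square limits under bounded Lipschitz maps *)

Section bounded_lipschitz_convergence.
Context {dp : measure_display} {T : measurableType dp} {R : realType}.
Variables (mu : {measure set T -> \bar R}) (D : set T).
Hypothesis mD : measurable D.
Implicit Types F G : R -> R.

Lemma measurable_bounded_lipschitz F (u0 : T -> R) : bounded_lipschitz F ->
  measurable_fun D u0 -> measurable_fun D (F \o u0).
Proof.
by move=> [cF _ _] mu0; apply: measurableT_comp => //; exact: continuous_measurable_fun.
Qed.

Lemma cvg_sqint_norm (u v : nat -> T -> R) (u0 v0 : T -> R) :
  (forall n, measurable_fun D (u n)) -> (forall n, measurable_fun D (v n)) ->
  measurable_fun D u0 -> measurable_fun D v0 ->
  (fun n => sqint mu D (u n \- u0)) @ \oo --> 0%E ->
  (fun n => sqint mu D (v n \- v0)) @ \oo --> 0%E ->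
  (fun n => sqint mu D (fun x => `|u n x - u0 x| + `|v n x - v0 x|)) @ \oo --> 0%E.
Proof.
move=> mu_ mv mu0 mv0 cu cv; apply: (cvge0_le2 (c1 := 2) (c2 := 2) _ _ cu cv).
  by move=> n; exact: sqint_ge0.
move=> n; apply: sqint_le2 => //; try exact: measurable_funB.
  by apply: measurable_funD; apply: measurableT_comp => //; exact: measurable_funB.
move=> x _ /=; have := sqr_ge0 (`|u n x - u0 x| - `|v n x - v0 x|).
rewrite -(real_normK (num_real (u n x - u0 x))) -(real_normK (num_real (v n x - v0 x))).
nra.
Qed.

Lemma lipschitz_product F G : bounded_lipschitz F -> bounded_lipschitz G ->
  exists2 C : R, 0 <= C & forall s s' t t',
    `|F s * G t - F s' * G t'| <= C * (`|s - s'| + `|t - t'|).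
Proof.
move=> FF GG; have [B B0 FB] := bounded_lipschitz_bound FF.
have [B' B'0 GB] := bounded_lipschitz_bound GG.
have [C C0 FC] := bounded_lipschitz_const FF.
have [C' C'0 GC] := bounded_lipschitz_const GG.
exists (B * C' + B' * C) => [|s s' t t']; first by rewrite addr_ge0 ?mulr_ge0.
have -> : F s * G t - F s' * G t' = F s * (G t - G t') + G t' * (F s - F s') by ring.
rewrite (le_trans (ler_normD _ _))// !normrM.
apply: (@le_trans _ _ (B * (C' * `|t - t'|) + B' * (C * `|s - s'|))).
  by apply: lerD; apply: ler_pM.
rewrite -subr_ge0 (_ : _ - _ = B * C' * `|s - s'| + B' * C * `|t - t'|); last by ring.
by rewrite addr_ge0// !mulr_ge0.
Qed.

Lemma cvg_bounded_lipschitz F G (u v : nat -> T -> R) (u0 v0 : T -> R) :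
  bounded_lipschitz F -> bounded_lipschitz G ->
  (forall n, measurable_fun D (u n)) -> (forall n, measurable_fun D (v n)) ->
  measurable_fun D u0 -> measurable_fun D v0 ->
  (fun n => sqint mu D (u n \- u0)) @ \oo --> 0%E ->
  (fun n => sqint mu D (v n \- v0)) @ \oo --> 0%E ->
  (fun n => sqint mu D (fun x => F (u n x) * G (v n x) - F (u0 x) * G (v0 x)))
    @ \oo --> 0%E.
Proof.
move=> FF GG mu_ mv mu0 mv0 cu cv; have [C C0 lip] := lipschitz_product FF GG.
have ca := cvg_sqint_norm mu_ mv mu0 mv0 cu cv.
apply: (cvge0_le2 (c1 := C ^+ 2) (c2 := 0) _ _ ca ca).
  by move=> n; exact: sqint_ge0.
have ma n : measurable_fun D (fun x => `|u n x - u0 x| + `|v n x - v0 x|).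
  by apply: measurable_funD; apply: measurableT_comp => //; exact: measurable_funB.
move=> n; apply: sqint_le2 => //; first exact: sqr_ge0.
  by apply: measurable_funB; apply: measurable_funM;
    exact: measurable_bounded_lipschitz.
move=> x _; rewrite mul0r addr0 -exprMn.
rewrite -[leLHS](real_normK (num_real _)) lerXn2r ?nnegrE//.
by rewrite mulr_ge0// addr_ge0.
Qed.

(** With c = F(u) G(v), split c_n p_n - c_0 p_0 as c_n (p_n - p_0) + (c_n - c_0) p_0. The first term
    is handled by boundedness of c_n. In the second [p0] may be unbounded, so the Lipschitz estimate
    alone does not suffice and [cvg_sqintM] is used. *)
Lemma cvg_bounded_lipschitzM F G (u v p : nat -> T -> R) (u0 v0 p0 : T -> R) :
  bounded_lipschitz F -> bounded_lipschitz G ->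
  (forall n, measurable_fun D (u n)) -> (forall n, measurable_fun D (v n)) ->
  (forall n, measurable_fun D (p n)) ->
  measurable_fun D u0 -> measurable_fun D v0 -> sq_integrable mu D p0 ->
  (fun n => sqint mu D (u n \- u0)) @ \oo --> 0%E ->
  (fun n => sqint mu D (v n \- v0)) @ \oo --> 0%E ->
  (fun n => sqint mu D (p n \- p0)) @ \oo --> 0%E ->
  (fun n => sqint mu D (fun x => F (u n x) * G (v n x) * p n x -
                               F (u0 x) * G (v0 x) * p0 x)) @ \oo --> 0%E.
Proof.
move=> FF GG mu_ mv mp mu0 mv0 ip0 cu cv cp; have [mp0 _] := ip0.
have [C C0 lip] := lipschitz_product FF GG.
have [B B0 FB] := bounded_lipschitz_bound FF.
have [B' B'0 GB] := bounded_lipschitz_bound GG.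
pose c n x := F (u n x) * G (v n x); pose c0 x := F (u0 x) * G (v0 x).
have mFG (f g : T -> R) : measurable_fun D f -> measurable_fun D g ->
    measurable_fun D (fun x => F (f x) * G (g x)).
  by move=> mf mg; apply: measurable_funM; exact: measurable_bounded_lipschitz.
have mc n : measurable_fun D (c n) by exact: mFG.
have mc0 : measurable_fun D c0 by exact: mFG.
have FGB s t : `|F s * G t| <= B * B' by rewrite normrM ler_pM.
have ma n : measurable_fun D (fun x => `|u n x - u0 x| + `|v n x - v0 x|).
  by apply: measurable_funD; apply: measurableT_comp => //; exact: measurable_funB.
have cI : (fun n => sqint mu D (c n \* (p n \- p0))) @ \oo --> 0%E.
  apply: (cvge0_le2 (c1 := (B * B') ^+ 2) (c2 := 0) _ _ cp cp).
    by move=> n; exact: sqint_ge0.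
  move=> n; rewrite mul0e adde0; apply: sqintM_le => // [|x _].
    exact: measurable_funB.
  exact: FGB.
have cII : (fun n => sqint mu D ((c n \- c0) \* p0)) @ \oo --> 0%E.
  apply: (@cvg_sqintM _ T R mu D mD
    (fun n x => `|u n x - u0 x| + `|v n x - v0 x|) (fun n => c n \- c0) p0
    (B * B' + B * B') C) => //.
  - by rewrite addr_ge0// mulr_ge0.
  - by move=> n; exact: measurable_funB.
  - by move=> n x _ /=; apply: (le_trans (ler_normB _ _)); apply: lerD; exact: FGB.
  - by move=> n x _ /=; rewrite [X in C * X]ger0_norm ?addr_ge0//; exact: lip.
  - exact: cvg_sqint_norm.
apply: (cvge0_le2 (c1 := 2) (c2 := 2) _ _ cI cII) => n.
  exact: sqint_ge0.
rewrite (_ : (fun x => _) = (c n \* (p n \- p0)) \+ ((c n \- c0) \* p0)).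
  apply: sqintD_le => //.
    by apply: measurable_funM => //; exact: measurable_funB.
  by apply: measurable_funM => //; exact: measurable_funB.
by apply/funext => x; rewrite /= /c /c0; ring.
Qed.

End bounded_lipschitz_convergence.

(** * Sobolev functions: linear combinations and the truncated product *)

Section sobolev_calculus.
Context {R : realType} {d : nat}.
Local Notation E := 'rV[R]_d.+1.
Local Notation leb := (@lebesgue R d).
Implicit Types (U : set E) (f g : nat -> E -> R) (u v w chi : sobfun R d).

Lemma smooth_measurable U (h : E -> R) : open U -> smooth U h ->
  measurable_fun (U : set (@lebesgue_space R d)) h.
Proof.
by move=> oU sh; apply: continuous_lebesgue_measurable => // x; exact: smooth_cont.
Qed.

Lemma sobfun_lin1 (a : R) u v x : (a *: u + v).1 x = a * u.1 x + v.1 x.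
Proof. by []. Qed.

Lemma sobfun_lin2 (a : R) u v x : (a *: u + v).2 x = a *: u.2 x + v.2 x.
Proof. by []. Qed.

Lemma partial_lin (a : R) (h k : E -> R) (j : 'I_d.+1) x :
  derivable h x (delta_mx 0 j) -> derivable k x (delta_mx 0 j) ->
  partial j (cst a \* h \+ k) x = a * partial j h x + partial j k x.
Proof.
move=> dh dk; rewrite /partial.
have da : derivable (cst a : E -> R) x (delta_mx 0 j) by exact: derivable_cst.
rewrite (deriveD (derivableM da dh) dk) (deriveM da dh) derive_cst scaler0 addr0.
by [].
Qed.

Lemma smooth_lin U (a : R) (h k : E -> R) : open U -> smooth U h -> smooth U k ->
  smooth U (cst a \* h \+ k).
Proof.
by move=> oU sh sk; apply: smoothD => //; apply: smoothM => //; exact: smooth_cst.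
Qed.

Lemma sq_integrable_lin U (a : R) (h k : E -> R) : open U ->
  sq_integrable leb U h -> sq_integrable leb U k ->
  sq_integrable leb U (cst a \* h \+ k).
Proof.
move=> oU ih ik; have mU := open_lebesgue_measurable oU.
apply: sq_integrableD => //; apply: (sq_integrableM mU (B := `|a|)) => //.
Qed.

Lemma finite_H1_norm_lin U (a : R) u v : open U ->
  finite_H1_norm U u -> finite_H1_norm U v -> finite_H1_norm U (a *: u + v).
Proof.
move=> oU [u1 u2] [v1 v2]; split; first exact: (sq_integrable_lin a oU u1 v1).
move=> j; have := sq_integrable_lin a oU (u2 j) (v2 j).
by rewrite (_ : _ \+ _ = (fun x => (a *: u + v).2 x 0 j))//; apply/funext => x;
  rewrite /= !mxE.
Qed.

Lemma cvg_H1_lin U (a : R) f g u v : open U ->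
  (forall n, smooth U (f n)) -> (forall n, smooth U (g n)) ->
  finite_H1_norm U u -> finite_H1_norm U v ->
  cvg_H1 U f u -> cvg_H1 U g v ->
  cvg_H1 U (fun n => cst a \* f n \+ g n) (a *: u + v).
Proof.
move=> oU sf sg [[mu1 _] u2] [[mv1 _] v2] [cf df] [cg dg].
have mU := open_lebesgue_measurable oU.
(* One estimate serves the functions and each partial derivative. [r] is prescribed on [U] only,
   because the formula for the derivative of a combination is available only there. *)
have lin (p q : nat -> E -> R) (p0 q0 : E -> R) (r : nat -> E -> R) :
    (forall n, measurable_fun (U : set (@lebesgue_space R d)) (p n)) ->
    (forall n, measurable_fun (U : set (@lebesgue_space R d)) (q n)) ->
    measurable_fun (U : set (@lebesgue_space R d)) p0 ->
    measurable_fun (U : set (@lebesgue_space R d)) q0 ->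
    (forall n x, U x -> r n x = a * (p n x - p0 x) + (q n x - q0 x)) ->
    (fun n => sqint leb U (p n \- p0)) @ \oo --> 0%E ->
    (fun n => sqint leb U (q n \- q0)) @ \oo --> 0%E ->
    (fun n => sqint leb U (r n)) @ \oo --> 0%E.
  move=> mp mq mp0 mq0 rE cp cq.
  apply: (cvge0_le2 (c1 := 2 * a ^+ 2) (c2 := 2) _ _ cp cq) => n.
    exact: sqint_ge0.
  apply: sqint_le2 => //.
  - by rewrite mulr_ge0// sqr_ge0.
  - exact: measurable_funB.
  - exact: measurable_funB.
  - apply: (@eq_measurable_fun _ _ (@lebesgue_space R d) R U ((cst a \* (p n \- p0)) \+ (q n \- q0))).
      by move=> x /[!inE] Ux; rewrite rE.
    apply: measurable_funD; last exact: measurable_funB.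
    by apply: measurable_funM => //; exact: measurable_funB.
  move=> x Ux; rewrite rE//=.
  by have := sqr_ge0 (a * (p n x - p0 x) - (q n x - q0 x)); nra.
split=> [|j].
  apply: (lin f g u.1 v.1) => // [n|n|n x Ux]; try exact: smooth_measurable.
  by rewrite sobfun_lin1 /=; ring.
have [mu2 _] := u2 j; have [mv2 _] := v2 j.
apply: (lin (fun n => partial j (f n)) (fun n => partial j (g n))
  (fun x => u.2 x 0 j) (fun x => v.2 x 0 j)) => // [n|n|n x Ux||].
- by apply: smooth_measurable => //; exact: smooth_partial.
- by apply: smooth_measurable => //; exact: smooth_partial.
- rewrite partial_lin; [|exact: smooth_derivable Ux|exact: smooth_derivable Ux].
  by rewrite sobfun_lin2 !mxE /=; ring.
- exact: df.
- exact: dg.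
Qed.

Lemma smooth_partial_lin U (a : R) (h k : E -> R) j x : smooth U h ->
  smooth U k -> U x ->
  partial j (cst a \* h \+ k) x = a * partial j h x + partial j k x.
Proof.
by move=> sh sk Ux; apply: partial_lin; exact: smooth_derivable Ux.
Qed.

Lemma H1_lin U (a : R) u v : open U -> H1 U u -> H1 U v -> H1 U (a *: u + v).
Proof.
move=> oU [uoo [f [sf cf]]] [voo [g [sg cg]]]; split.
  exact: finite_H1_norm_lin.
have mU := open_lebesgue_measurable oU.
exists (fun n => cst a \* f n \+ g n); split=> [n|]; last first.
  by apply: cvg_H1_lin => // n; [case: (sf n)|case: (sg n)].
have [sfn [f1 f2]] := sf n; have [sgn [g1 g2]] := sg n.
split; first exact: smooth_lin.
split=> [|j]; first exact: (sq_integrable_lin a oU f1 g1).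
apply: sq_integrable_eq (sq_integrable_lin a oU (f2 j) (g2 j)) => x Ux.
by rewrite /= !mxE (smooth_partial_lin _ _ sfn sgn Ux).
Qed.

Lemma smooth0 U : smooth U (0 : E -> R).
Proof. exact: (smooth_cst U 0). Qed.

Lemma sq_integrable0 U : open U -> sq_integrable leb U (0 : E -> R).
Proof.
move=> oU; split; first exact: measurable_cst.
rewrite /sqint (eq_integral (cst 0%E)) ?integral_cst ?mul0e//.
- exact: open_lebesgue_measurable.
- by move=> x _; rewrite expr0n.
Qed.

Lemma partial0 j : partial j (0 : E -> R) = 0.
Proof. by apply/funext => x; exact: derive_cst. Qed.

Lemma finite_H1_norm0 U : open U -> finite_H1_norm U (0 : sobfun R d).
Proof.
move=> oU; split=> [|j]; first exact: sq_integrable0.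
rewrite (_ : (fun x => _) = 0); first exact: sq_integrable0.
by apply/funext => x; rewrite mxE.
Qed.

Lemma cvg_H10 U : cvg_H1 U (fun=> 0) (0 : sobfun R d).
Proof.
have z (h : E -> R) : (forall x, h x = 0) ->
    (fun n : nat => \int[leb]_(x in U) (h x ^+ 2)%:E)%E @ \oo --> 0%E.
  move=> h0; rewrite (_ : (fun=> _) = cst 0%E); first exact: cvg_cst.
  by apply/funext => n; apply: integral0_eq => x _; rewrite h0 expr0n.
split=> [|j]; apply: z => x; first by rewrite /= subr0.
by rewrite partial0 mxE subr0.
Qed.

Lemma H1_0 U : open U -> H1 U (0 : sobfun R d).
Proof.
move=> oU; split; first exact: finite_H1_norm0.
exists (fun=> 0); split; last exact: cvg_H10.
move=> n; split; first exact: smooth0.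
split=> [|j]; first exact: sq_integrable0.
rewrite (_ : (fun x => _) = 0); first exact: sq_integrable0.
by apply/funext => x; rewrite mxE partial0.
Qed.

Lemma H1_scale U (a : R) u : open U -> H1 U u -> H1 U (a *: u).
Proof.
by move=> oU Hu; rewrite -[a *: u]addr0; apply: H1_lin => //; exact: H1_0.
Qed.

Lemma H10_scale U (a : R) u : open U -> H10 U u -> H10 U (a *: u).
Proof.
move=> oU [uoo [f [tf cf]]]; rewrite -[a *: u]addr0; split.
  by apply: finite_H1_norm_lin => //; exact: finite_H1_norm0.
exists (fun n => cst a \* f n \+ 0); split; last first.
  apply: cvg_H1_lin => //; last exact: cvg_H10.
  - by move=> n; case: (tf n).
  - by move=> n; exact: smooth0.
  - exact: finite_H1_norm0.
move=> n; have [sfn [K [cK KU f0]]] := tf n; split.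
  by apply: smooth_lin => //; exact: smooth0.
by exists K; split => // x Kx; rewrite /= f0// mulr0 addr0.
Qed.

(* The second component is the gradient of the first, by the chain rule. *)
Definition trunc_prod chi w : sobfun R d :=
  ((fun x => sqtrunc (chi.1 x) * trunc (w.1 x)),
   (fun x => (dsqtrunc (chi.1 x) * trunc (w.1 x)) *: chi.2 x +
             (sqtrunc (chi.1 x) * dtrunc (w.1 x)) *: w.2 x)).

Lemma partial_trunc_prod (h k : E -> R) j x :
  derivable h x (delta_mx 0 j) -> derivable k x (delta_mx 0 j) ->
  partial j ((sqtrunc \o h) \* (trunc \o k)) x =
  dsqtrunc (h x) * trunc (k x) * partial j h x +
  sqtrunc (h x) * dtrunc (k x) * partial j k x.
Proof.
move=> /derivableP/is_derive_trunc[dh eh] /derivableP/is_derive_trunc[dk ek].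
rewrite /partial (_ : _ \* _ = (trunc \o h) * (trunc \o h) * (trunc \o k)).
  rewrite (deriveM (derivableM dh dh) dk) (deriveM dh dh) eh ek.
  set a := 'D_(delta_mx 0 j) h x; set b := 'D_(delta_mx 0 j) k x.
  transitivity (trunc (h x) * trunc (h x) * (dtrunc (k x) * b) + trunc (k x) *
    (trunc (h x) * (dtrunc (h x) * a) + trunc (h x) * (dtrunc (h x) * a))) => //.
  by rewrite /sqtrunc /dsqtrunc; ring.
by apply/funext => y; rewrite /= /sqtrunc expr2.
Qed.

(** Take test functions f_n tending to chi and smooth g_n tending to w. Then trunc(f_n)^2 trunc(g_n)
    is again a test function: [trunc] is smooth, and trunc 0 = 0 keeps the support inside that of
    f_n. The two terms of the chain rule converge separately, each being a bounded Lipschitz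
    coefficient times a converging derivative. *)
Lemma H10_trunc_prod U chi w : open U -> H10 U chi -> H1 U w ->
  H10 U (trunc_prod chi w).
Proof.
move=> oU [[chi1 chi2] [f [tf [cf df]]]] [[w1 w2] [g [sg [cg dg]]]].
have mU := open_lebesgue_measurable oU.
have sf n : smooth U (f n) by case: (tf n).
have {}sg n : smooth U (g n) by case: (sg n).
have [mchi _] := chi1; have [mw _] := w1.
have [B B0 sqB] := bounded_lipschitz_bound (@bounded_lipschitz_sqtrunc R).
have [B' B'0 dsqB] := bounded_lipschitz_bound (@bounded_lipschitz_dsqtrunc R).
have msq := measurable_bounded_lipschitz (@bounded_lipschitz_sqtrunc R) mchi.
have mdsq := measurable_bounded_lipschitz (@bounded_lipschitz_dsqtrunc R) mchi.
have mt := measurable_bounded_lipschitz (@bounded_lipschitz_trunc R) mw.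
have mdt := measurable_bounded_lipschitz (@bounded_lipschitz_dtrunc R) mw.
have mf n : measurable_fun (U : set (@lebesgue_space R d)) (f n).
  exact: smooth_measurable.
have mg n : measurable_fun (U : set (@lebesgue_space R d)) (g n).
  exact: smooth_measurable.
have mdf n j : measurable_fun (U : set (@lebesgue_space R d)) (partial j (f n)).
  by apply: smooth_measurable => //; exact: smooth_partial.
have mdg n j : measurable_fun (U : set (@lebesgue_space R d)) (partial j (g n)).
  by apply: smooth_measurable => //; exact: smooth_partial.
split.
  split=> [|j].
    apply: (sq_integrableM mU (B := B) (b := sqtrunc \o chi.1)) => [//|x _|].
      exact: sqB.
    by apply: le_sq_integrable w1 => // x _; exact: norm_trunc_le.
  have -> : (fun x => (trunc_prod chi w).2 x 0 j) =
      (((sqtrunc \o chi.1) \* (dtrunc \o w.1)) \* (fun x => w.2 x 0 j)) \+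
      (((dsqtrunc \o chi.1) \* (trunc \o w.1)) \* (fun x => chi.2 x 0 j)).
    by apply/funext => x; rewrite /= !mxE addrC.
  apply: sq_integrableD => //.
    apply: (sq_integrableM mU (B := B)
      (b := (sqtrunc \o chi.1) \* (dtrunc \o w.1)) (u := fun x => w.2 x 0 j)) => [|x _|].
    - exact: (measurable_funM msq mdt).
    - by rewrite /= normrM -[leRHS]mulr1 ler_pM// norm_dtrunc.
    - exact: w2.
  apply: (sq_integrableM mU (B := B')
    (b := (dsqtrunc \o chi.1) \* (trunc \o w.1)) (u := fun x => chi.2 x 0 j)) => [|x _|].
  - exact: (measurable_funM mdsq mt).
  - by rewrite /= normrM -[leRHS]mulr1 ler_pM// norm_trunc.
  - exact: chi2.
exists (fun n => (sqtrunc \o f n) \* (trunc \o g n)); split=> [n|].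
  have [_ [K [cK KU f0]]] := tf n; split.
    apply: smoothM => //; last exact: smooth_trunc.
    rewrite (_ : sqtrunc \o f n = (trunc \o f n) \* (trunc \o f n)).
      by apply: smoothM => //; exact: smooth_trunc.
    by apply/funext => x; rewrite /= /sqtrunc expr2.
  exists K; split => // x Kx.
  by rewrite /= f0// /sqtrunc trunc0 expr0n mul0r.
split=> [|j].
  exact: (cvg_bounded_lipschitz mU (@bounded_lipschitz_sqtrunc R)
    (@bounded_lipschitz_trunc R)).
have [mchi2 _] := chi2 j; have [mw2 _] := w2 j.
have c1 := cvg_bounded_lipschitzM mU (@bounded_lipschitz_dsqtrunc R)
  (@bounded_lipschitz_trunc R) mf mg (mdf^~ j) mchi mw (chi2 j) cf cg (df j).
have c2 := cvg_bounded_lipschitzM mU (@bounded_lipschitz_sqtrunc R)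
  (@bounded_lipschitz_dtrunc R) mf mg (mdg^~ j) mchi mw (w2 j) cf cg (dg j).
apply: (cvge0_le2 (c1 := 2) (c2 := 2) _ _ c1 c2) => n; first exact: sqint_ge0.
have mprod (F G : R -> R) (p q r : E -> R) : bounded_lipschitz F ->
    bounded_lipschitz G -> measurable_fun (U : set (@lebesgue_space R d)) p ->
    measurable_fun (U : set (@lebesgue_space R d)) q ->
    measurable_fun (U : set (@lebesgue_space R d)) r ->
    measurable_fun (U : set (@lebesgue_space R d)) (fun x => F (p x) * G (q x) * r x).
  move=> FF GG mp mq mr; exact: (measurable_funM (measurable_funM
    (measurable_bounded_lipschitz FF mp) (measurable_bounded_lipschitz GG mq)) mr).
have m1 : measurable_fun (U : set (@lebesgue_space R d)) (fun x =>
    dsqtrunc (f n x) * trunc (g n x) * partial j (f n) x -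
    dsqtrunc (chi.1 x) * trunc (w.1 x) * chi.2 x 0 j).
  by apply: measurable_funB; apply: mprod => //;
    first [exact: bounded_lipschitz_dsqtrunc|exact: bounded_lipschitz_trunc].
have m2 : measurable_fun (U : set (@lebesgue_space R d)) (fun x =>
    sqtrunc (f n x) * dtrunc (g n x) * partial j (g n) x -
    sqtrunc (chi.1 x) * dtrunc (w.1 x) * w.2 x 0 j).
  by apply: measurable_funB; apply: mprod => //;
    first [exact: bounded_lipschitz_sqtrunc|exact: bounded_lipschitz_dtrunc].
apply: le_trans (sqintD_le leb mU m1 m2); rewrite le_eqVlt; apply/orP; left.
apply/eqP; apply: sqint_eq => x Ux.
rewrite partial_trunc_prod; [|exact: smooth_derivable Ux..].
by rewrite /= !mxE; ring.
Qed.

End sobolev_calculus.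

(** * Pointwise Young inequality and the Caccioppoli estimate *)

Section dot_product.
Context {R : realType} {d : nat}.
Implicit Types (x y z : 'rV[R]_d.+1).

Lemma dotC x y : dot x y = dot y x.
Proof. by apply: eq_bigr => j _; rewrite mulrC. Qed.

Lemma dotDr x y z : dot x (y + z) = dot x y + dot x z.
Proof. by rewrite /dot -big_split; apply: eq_bigr => j _; rewrite mxE mulrDr. Qed.

Lemma dotZr (a : R) x y : dot x (a *: y) = a * dot x y.
Proof. by rewrite /dot mulr_sumr; apply: eq_bigr => j _; rewrite mxE mulrCA. Qed.

Lemma dotDl x y z : dot (y + z) x = dot y x + dot z x.
Proof. by rewrite dotC dotDr !(dotC x). Qed.

Lemma dotZl (a : R) x y : dot (a *: y) x = a * dot y x.
Proof. by rewrite dotC dotZr (dotC x). Qed.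

Lemma dot_ge0 x : 0 <= dot x x.
Proof. by apply: sumr_ge0 => j _; rewrite -expr2 sqr_ge0. Qed.

(* Up to the factor [k], the difference of the two sides is
   [1/2 |s q + 2 m p|^2 + 2 (w^2 - m^2) |p|^2] with [m = s' t / e]. *)
Lemma young_trunc (k s s' t t' e w : R) (p q : 'rV[R]_d.+1) :
  0 <= k -> 0 < e -> `|s'| <= 1 -> `|t| <= `|e * w| ->
  s ^+ 2 * k * (t' + 1) * dot q q <=
  e^-1 * (k * dot q ((2 * s * s' * t) *: p + (s ^+ 2 * t') *: (e *: q))) +
  (3 / 2 * (s ^+ 2 * k * dot q q) + 2 * (k * dot p p * w ^+ 2)).
Proof.
move=> k0 e0 s1 te; pose m := s' * (t / e).
have mw : m ^+ 2 <= w ^+ 2.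
  rewrite -[leLHS](real_normK (num_real _)) -[leRHS](real_normK (num_real _)).
  rewrite lerXn2r ?nnegrE// -[leRHS]mul1r /m normrM ler_pM// normrM.
  by rewrite normfV (gtr0_norm e0) ler_pdivrMr// mulrC -(gtr0_norm e0) -normrM.
rewrite dotDr !dotZr -subr_ge0.
rewrite (_ : _ - _ = k * (1 / 2 * dot (s *: q + (2 * m) *: p) (s *: q + (2 * m) *: p) +
   2 * (w ^+ 2 - m ^+ 2) * dot p p)); last first.
  rewrite !(dotDr, dotDl, dotZr, dotZl) (dotC p q) /m; field.
  by rewrite gt_eqF.
apply: mulr_ge0 => //; apply: addr_ge0; apply: mulr_ge0; rewrite ?dot_ge0//.
by rewrite mulr_ge0// subr_ge0.
Qed.

End dot_product.

Section caccioppoli.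
Context {R : realType} {d : nat}.
Local Notation E := 'rV[R]_d.+1.
Local Notation leb := (@lebesgue R d).
Variables (U : set E) (kappa : E -> R) (B : R).
Hypothesis oU : open U.
Hypothesis mkappa : measurable_fun (U : set (@lebesgue_space R d)) kappa.
Hypothesis kappaB : forall x, U x -> 0 <= kappa x <= B.
Implicit Types (u v w chi : sobfun R d).

Let mU : measurable (U : set (@lebesgue_space R d)).
Proof. exact: open_lebesgue_measurable. Qed.

Let norm_kappa x : U x -> `|kappa x| <= B.
Proof. by move=> /kappaB/andP[k0 kB]; rewrite ger0_norm. Qed.

Lemma integrable_energy (b : E -> R) (M : R) u v :
  measurable_fun (U : set (@lebesgue_space R d)) b ->
  (forall x, U x -> `|b x| <= M) ->
  finite_H1_norm U u -> finite_H1_norm U v ->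
  leb.-integrable U (fun x => (b x * dot (u.2 x) (v.2 x))%:E).
Proof.
move=> mb bM [_ u2] [_ v2].
have : leb.-integrable U (fun x => \sum_(j <- index_enum 'I_d.+1)
    (b x * (u.2 x 0 j * v.2 x 0 j))%:E)%E.
  apply: integrable_sum => // j _.
  exact: (integrable_weighted_product mU mb bM (u2 j) (v2 j)).
by apply: eq_integrable => // x _; rewrite sumEFin -mulr_sumr.
Qed.

(** The real-valued integral is additive only on integrable functions; the bound on [kappa] and the
    finite H^1 norms provide integrability. *)
Lemma weakly_harmonic_lin (a : R) u v : finite_H1_norm U u ->
  finite_H1_norm U v -> weakly_harmonic kappa U u -> weakly_harmonic kappa U v ->
  weakly_harmonic kappa U (a *: u + v).
Proof.
move=> iu iv hu hv z Hz; have [iz _] := Hz.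
have eu := integrable_energy mkappa norm_kappa iu iz.
have ev := integrable_energy mkappa norm_kappa iv iz.
transitivity (\int[leb]_(x in U)
    (a * (kappa x * dot (u.2 x) (z.2 x)) + kappa x * dot (v.2 x) (z.2 x))).
  by apply: eq_Rintegral => x _; rewrite sobfun_lin2 dotDl dotZl mulrDr mulrCA.
rewrite RintegralD//; last first.
  by have := integrableZl mU a eu; apply: eq_integrable => // x _; rewrite EFinM.
by rewrite RintegralZl// hu// hv// mulr0 addr0.
Qed.

Lemma weakly_harmonic0 : weakly_harmonic kappa U (0 : sobfun R d).
Proof.
move=> z _; rewrite /Rintegral integral0_eq// => x _.
by rewrite (_ : (0 : sobfun R d).2 x = 0 *: 0) ?dotZl ?mul0r ?mulr0// scale0r.
Qed.

Lemma measurable_dot u v : finite_H1_norm U u -> finite_H1_norm U v ->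
  measurable_fun (U : set (@lebesgue_space R d)) (fun x => dot (u.2 x) (v.2 x)).
Proof.
move=> [_ u2] [_ v2]; apply: measurable_sum => j; apply: measurable_funM.
  by case: (u2 j).
by case: (v2 j).
Qed.

(* Test the equation with (truncated chi)^2 times the truncation of [e w], then
   let [e] tend to [0]. *)
Lemma caccioppoli_trunc chi w : H10 U chi -> H1 U w -> weakly_harmonic kappa U w ->
  (\int[leb]_(x in U)
      (sqtrunc (chi.1 x) * kappa x * dot (w.2 x) (w.2 x))%:E
   <= 4%:E * \int[leb]_(x in U)
      (kappa x * dot (chi.2 x) (chi.2 x) * w.1 x ^+ 2)%:E)%E.
Proof.
move=> Hchi Hw hw; have [ichi _] := Hchi; have [iw _] := Hw.
have [[mchi _] _] := ichi; have [[mw _] _] := iw.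
pose e1 x := sqtrunc (chi.1 x) * kappa x * dot (w.2 x) (w.2 x).
pose e2 x := kappa x * dot (chi.2 x) (chi.2 x) * w.1 x ^+ 2.
have e10 x : U x -> 0 <= e1 x.
  move=> Ux; have /andP[k0 _] := kappaB Ux.
  by rewrite mulr_ge0 ?dot_ge0// mulr_ge0// sqr_ge0.
have e20 x : U x -> 0 <= e2 x.
  move=> Ux; have /andP[k0 _] := kappaB Ux.
  by rewrite mulr_ge0 ?sqr_ge0// mulr_ge0// dot_ge0.
have msq := measurable_bounded_lipschitz (@bounded_lipschitz_sqtrunc R) mchi.
have me2 : measurable_fun (U : set (@lebesgue_space R d)) e2.
  apply: measurable_funM; last exact: measurable_funX.
  exact: (measurable_funM mkappa (measurable_dot ichi ichi)).
have ie1 : leb.-integrable U (EFin \o e1).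
  have [C _ sqC] := bounded_lipschitz_bound (@bounded_lipschitz_sqtrunc R).
  apply: (integrable_energy (b := fun x => sqtrunc (chi.1 x) * kappa x) (M := C * B)) => [|x Ux||].
  - exact: (measurable_funM msq mkappa).
  - by rewrite normrM ler_pM// norm_kappa.
  - exact: iw.
  - exact: iw.
have /integrableP[me1 _] := ie1.
have fin1 : (\int[leb]_(x in U) (e1 x)%:E)%E \is a fin_num.
  exact: (integrable_fin_num mU ie1).
have I20 : (0 <= \int[leb]_(x in U) (e2 x)%:E)%E.
  by apply: integral_ge0 => x Ux; rewrite lee_fin e20.
(* If the right-hand integral is infinite there is nothing to prove; otherwise [e2] is integrable
   and the Young bound can be integrated term by term. *)
have [oo|fin] := eqVneq (\int[leb]_(x in U) (e2 x)%:E)%E +oo%E.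
  by rewrite -/e2 oo gt0_muley ?leey// lte_fin.
have ie2 : leb.-integrable U (EFin \o e2).
  apply/integrableP; split; first exact/measurable_EFinP.
  have -> : (\int[leb]_(x in U) `|(EFin \o e2) x| = \int[leb]_(x in U) (e2 x)%:E)%E.
    by apply: eq_integral => x /[!inE] Ux; rewrite /= ger0_norm// e20.
  by rewrite ltey.
have fin2 : (\int[leb]_(x in U) (e2 x)%:E)%E \is a fin_num.
  exact: (integrable_fin_num mU ie2).
(* Since [dtrunc] is at least -1, the summand 1 makes this integrand nonnegative, as Fatou's lemma
   requires. *)
pose Fe (e : R) x :=
  sqtrunc (chi.1 x) * kappa x * (dtrunc (e * w.1 x) + 1) * dot (w.2 x) (w.2 x).
have mFe e : measurable_fun (U : set (@lebesgue_space R d)) (Fe e).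
  apply: measurable_funM; last exact: measurable_dot.
  apply: measurable_funM; first exact: (measurable_funM msq mkappa).
  apply: measurable_funD; last exact: measurable_cst.
  have mew : measurable_fun (U : set (@lebesgue_space R d)) (cst e \* w.1).
    exact: measurable_funM.
  exact: (measurable_bounded_lipschitz (@bounded_lipschitz_dtrunc R) mew).
have Fe0 e x : U x -> 0 <= Fe e x.
  move=> Ux; have /andP[k0 _] := kappaB Ux.
  have := norm_dtrunc (e * w.1 x); rewrite ler_norml => /andP[d1 _].
  rewrite mulr_ge0 ?dot_ge0// mulr_ge0//; first by rewrite mulr_ge0// sqr_ge0.
  by rewrite -lerBlDr sub0r.
(* In 3/2, the part 1 balances the summand added in [Fe] and the part 1/2 is the Young term; 2 is
   the matching Young weight. *)
pose bnd := ((3 / 2)%:E * \int[leb]_(x in U) (e1 x)%:E +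
             2%:E * \int[leb]_(x in U) (e2 x)%:E)%E.
have Fe_le e : 0 < e -> (\int[leb]_(x in U) (Fe e x)%:E <= bnd)%E.
  move=> e_gt0; have Hv := H10_trunc_prod oU Hchi (H1_scale e oU Hw).
  set v := trunc_prod _ _ in Hv; have [iv _] := Hv.
  have iZ := integrable_energy mkappa norm_kappa iw iv.
  (* The weak equation concerns the real integral, which is also 0 when the extended one is
     infinite; integrability rules that out. *)
  have Z0 : (\int[leb]_(x in U) (kappa x * dot (w.2 x) (v.2 x))%:E = 0)%E.
    by rewrite -[LHS]fineK; [congr (_%:E); exact: hw|exact: integrable_fin_num].
  have iG1 := integrableZl mU (3 / 2) ie1; have iG2 := integrableZl mU 2 ie2.
  have iG12 := integrableD mU iG1 iG2; have iZe := integrableZl mU e^-1 iZ.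
  have -> : bnd = (\int[leb]_(x in U)
      ((e^-1)%:E * (kappa x * dot (w.2 x) (v.2 x))%:E +
       ((3 / 2)%:E * (e1 x)%:E + 2%:E * (e2 x)%:E)))%E.
    rewrite integralD// integralZl// Z0 mule0 add0e.
    by rewrite integralD// !integralZl.
  have /integrableP[mG _] := integrableD mU iZe iG12.
  have le x : U x -> ((Fe e x)%:E <= (e^-1)%:E * (kappa x * dot (w.2 x) (v.2 x))%:E +
       ((3 / 2)%:E * (e1 x)%:E + 2%:E * (e2 x)%:E))%E.
    move=> Ux; have /andP[k0 _] := kappaB Ux.
    rewrite -!EFinM -!EFinD lee_fin.
    exact: (young_trunc (trunc (chi.1 x)) (dtrunc (e * w.1 x)) (chi.2 x) (w.2 x)
      k0 e_gt0 (norm_dtrunc (chi.1 x)) (norm_trunc_le (e * w.1 x))).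
  apply: ge0_le_integral; [exact: mU| | |exact: mG|exact: le].
    by move=> x Ux; rewrite lee_fin Fe0.
  by apply/measurable_EFinP; exact: mFe.
(* As dtrunc 0 = 1, [Fe] tends pointwise to [2 * e1] along e = 1 / (n + 1). *)
have lim : (\int[leb]_(x in U) (2 * e1 x)%:E <= bnd)%E.
  apply: (fatou_bound mU (f := fun n => Fe (n.+1%:R^-1))) => [//|n x Ux|x Ux|n].
  - exact: Fe0.
  - rewrite (_ : 2 * e1 x = sqtrunc (chi.1 x) * kappa x * (dtrunc (0 * w.1 x) + 1) *
        dot (w.2 x) (w.2 x)); last by rewrite mul0r dtrunc0 /e1; ring.
    apply: cvgM; last exact: cvg_cst.
    apply: cvgM; first exact: cvg_cst.
    apply: cvgD; last exact: cvg_cst.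
    apply: continuous_cvg; first exact: continuous_dtrunc.
    by apply: cvgM; [exact: cvg_harmonic|exact: cvg_cst].
  - by apply: Fe_le; rewrite invr_gt0.
have E2 : (\int[leb]_(x in U) (2 * e1 x)%:E = 2%:E * \int[leb]_(x in U) (e1 x)%:E)%E.
  by under eq_integral do rewrite EFinM; rewrite integralZl.
move: lim; rewrite E2 /bnd -/e1 -/e2 -(fineK fin1) -(fineK fin2) -!EFinM -!EFinD !lee_fin.
lra.
Qed.

(** Apply the truncated estimate to a chi with a = 1 / (n + 1) and divide by a^2. The right-hand
    side is quadratic in chi, hence no longer depends on n, while trunc(a chi)^2 / a^2 tends
    pointwise to chi^2. *)
Lemma caccioppoli chi w : H10 U chi -> H1 U w -> weakly_harmonic kappa U w ->
  (\int[leb]_(x in U)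
      (chi.1 x ^+ 2 * kappa x * dot (w.2 x) (w.2 x))%:E
   <= 4%:E * \int[leb]_(x in U)
      (kappa x * dot (chi.2 x) (chi.2 x) * w.1 x ^+ 2)%:E)%E.
Proof.
move=> Hchi Hw hw; have [ichi _] := Hchi; have [iw _] := Hw.
have [[mchi _] _] := ichi; have [[mw _] _] := iw.
pose e2 x := kappa x * dot (chi.2 x) (chi.2 x) * w.1 x ^+ 2.
have me2 : measurable_fun (U : set (@lebesgue_space R d)) e2.
  apply: measurable_funM; last exact: measurable_funX.
  exact: (measurable_funM mkappa (measurable_dot ichi ichi)).
have e20 x : U x -> 0 <= e2 x.
  move=> Ux; have /andP[k0 _] := kappaB Ux.
  by rewrite mulr_ge0 ?sqr_ge0// mulr_ge0// dot_ge0.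
pose g (e : R) x := sqtrunc (e * chi.1 x) * kappa x * dot (w.2 x) (w.2 x).
have g0 e x : U x -> 0 <= g e x.
  move=> Ux; have /andP[k0 _] := kappaB Ux.
  by rewrite mulr_ge0 ?dot_ge0// mulr_ge0// sqr_ge0.
have mg e : measurable_fun (U : set (@lebesgue_space R d)) (g e).
  apply: measurable_funM; last exact: measurable_dot.
  apply: measurable_funM; last exact: mkappa.
  have mec : measurable_fun (U : set (@lebesgue_space R d)) (cst e \* chi.1).
    exact: measurable_funM.
  exact: (measurable_bounded_lipschitz (@bounded_lipschitz_sqtrunc R) mec).
apply: (fatou_bound mU (f := fun n x => n.+1%:R ^+ 2 * g (n.+1%:R^-1) x))
  => [n|n x Ux|x Ux|n].
- by apply: measurable_funM; [exact: measurable_cst|exact: mg].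
- by rewrite mulr_ge0 ?sqr_ge0// g0.
(* Since trunc t = t damp t, the factor (n + 1)^2 cancels and a product of converging factors
   remains. *)
- have -> : (fun n => n.+1%:R ^+ 2 * g (n.+1%:R^-1) x) =
      (fun n => chi.1 x * damp (n.+1%:R^-1 * chi.1 x) *
                 (chi.1 x * damp (n.+1%:R^-1 * chi.1 x)) * kappa x * dot (w.2 x) (w.2 x)).
    by apply/funext => n; rewrite /g /sqtrunc /trunc; field.
  have cdamp : chi.1 x * damp (n.+1%:R^-1 * chi.1 x) @[n --> \oo] --> chi.1 x.
    have e0 : chi.1 x = chi.1 x * damp (0 * chi.1 x) by rewrite mul0r damp0 mulr1.
    rewrite [X in _ --> X]e0.
    apply: cvgM; first exact: cvg_cst.
    apply: continuous_cvg; first exact: continuous_damp.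
    by apply: cvgM; [exact: cvg_harmonic|exact: cvg_cst].
  rewrite expr2.
  apply: cvgM; last exact: cvg_cst.
  apply: cvgM; last exact: cvg_cst.
  by apply: cvgM.
- have scale (c : R) (h : E -> R) : 0 <= c ->
      measurable_fun (U : set (@lebesgue_space R d)) h -> (forall x, U x -> 0 <= h x) ->
      (\int[leb]_(x in U) (c * h x)%:E = c%:E * \int[leb]_(x in U) (h x)%:E)%E.
    move=> c0 mh h0; under eq_integral do rewrite EFinM.
    apply: (@ge0_integralZl_EFin _ (@lebesgue_space R d) R leb U mU (EFin \o h)) c0.
      by move=> x Ux; rewrite lee_fin h0.
    exact/measurable_EFinP.
  rewrite (scale _ _ (sqr_ge0 _) (mg _) (g0 _)).
  have := caccioppoli_trunc (H10_scale (n.+1%:R^-1) oU Hchi) Hw hw.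
  have -> : (\int[leb]_(x in U) (kappa x *
      dot ((n.+1%:R^-1 *: chi).2 x) ((n.+1%:R^-1 *: chi).2 x) * w.1 x ^+ 2)%:E =
      (n.+1%:R ^- 2)%:E * \int[leb]_(x in U) (e2 x)%:E)%E.
    have c0 : 0 <= (n.+1%:R : R) ^- 2 by rewrite invr_ge0 sqr_ge0.
    rewrite -(scale _ _ c0 me2 e20).
    apply: eq_integral => x _; congr (_%:E).
    rewrite [(_ *: chi).2 x]/(n.+1%:R^-1 *: chi.2 x) dotZl dotZr /e2; field.
    by rewrite addr_eq0 gt_eqF.
  move=> /(lee_wpmul2l (x := (n.+1%:R ^+ 2)%:E)) H.
  apply: (le_trans (H _)); first by rewrite lee_fin sqr_ge0.
  have n0 : (n.+1%:R : R) ^+ 2 != 0 by rewrite expf_neq0.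
  by rewrite muleCA (muleA (n.+1%:R ^+ 2)%:E) -EFinM (mulfV n0) mul1e.
Qed.

End caccioppoli.

(** * Comparison of integrals without measurability *)

Section integral_lower_bound.
Import HBNNSimple.
Context {dp : measure_display} {T : measurableType dp} {R : realType}.
Variables (mu : {measure set T -> \bar R}).
Local Open Scope ereal_scope.

(** The integral of a nonnegative function is a supremum over the simple functions below it, and a
    simple function below [f] is below [g]. *)
Lemma ge0_le_integralT (f g : T -> \bar R) : (forall x, 0 <= f x) ->
  (forall x, f x <= g x) -> \int[mu]_x f x <= \int[mu]_x g x.
Proof.
move=> f0 fg; rewrite !ge0_integralTE//; last first.
  by move=> x; exact: le_trans (fg x).
apply: ereal_sup_le => _ [h /= hf <-]; exists h => // x.
exact: le_trans (hf x) (fg x).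
Qed.

(** Any nonnegative simple function below [f] vanishes off the null set [A]. It is measurable even
    when [f] is not, so its integral is 0. *)
Lemma integral_null_support (A : set T) (f : T -> \bar R) : measurable A ->
  mu A = 0 -> (forall x, 0 <= f x) -> (forall x, ~ A x -> f x = 0) ->
  \int[mu]_x f x = 0.
Proof.
move=> mA A0 f0 fA; apply/eqP; rewrite eq_le integral_ge0// andbT.
rewrite ge0_integralTE//; apply: ge_ereal_sup => _ [h /= hf <-].
rewrite -integralT_nnsfun (ge0_negligible_integral mA)//; last 2 first.
- exact/measurable_EFinP.
- by move=> x _; rewrite lee_fin.
rewrite integral0_eq// => x [_ Ax].
by apply/eqP; rewrite eq_le -[X in _ <= X](fA _ Ax) hf lee_fin fun_ge0.
Qed.

(* The upper function [h] is not assumed to be measurable. *)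
Lemma ae_le_integral_nonmeasurable (D A : set T) (g h : T -> \bar R) :
  measurable D -> measurable A -> mu A = 0 -> measurable_fun D g ->
  (forall x, D x -> 0 <= g x) -> (forall x, D x -> ~ A x -> g x <= h x) ->
  \int[mu]_(x in D) g x <= \int[mu]_(x in D) h x.
Proof.
move=> mD mA A0 mg g0 gh.
have h0 x : D x -> ~ A x -> 0 <= h x.
  by move=> Dx Ax; exact: le_trans (g0 _ Dx) (gh _ Dx Ax).
(* The negative part of [h] on [D] lives on the null set [A]. *)
have hneg : \int[mu]_(x in D) h^\- x = 0.
  rewrite integral_mkcond; apply: (integral_null_support mA A0) => x.
    by apply: erestrict_ge0 => y _; exact: funeneg_ge0.
  move=> Ax; rewrite patchE; case: ifPn => // /[!inE] Dx.
  by rewrite funenegE; apply/max_idPr; rewrite leeNl oppe0 h0.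
(* [A] is removed on the side of [g] only, where measurability is known; on the other side the
   larger set [D] only helps, as the positive part is nonnegative. *)
rewrite [leRHS]integralE hneg sube0 (ge0_negligible_integral mA)//.
rewrite [leLHS]integral_mkcond [leRHS]integral_mkcond.
apply: ge0_le_integralT => x.
  by apply: erestrict_ge0 => y [Dy _]; exact: g0.
rewrite !patchE; case: ifPn => [/[!inE] -[Dx Ax]|_].
  by rewrite mem_set//; apply: le_trans (gh _ Dx Ax) _; rewrite funeposE le_max lexx.
by case: ifPn => // _; exact: funepos_ge0.
Qed.

End integral_lower_bound.

(** * Geometry of the domain and of its meshes *)

Section mesh_geometry.
Context {R : realType} {d : nat}.
Local Notation E := 'rV[R]_d.+1.
Implicit Types (x y z e : E) (D : set E).

Lemma continuous_dot_l e : continuous (fun z : E => dot z e).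
Proof.
have := @continuous_big R _ +%R 0 xpredT (@add_continuous _) E (index_enum 'I_d.+1)
  (fun j (z : E) => z 0 j * e 0 j); apply=> j _ z.
by apply: continuousM; [exact: coord_continuous|exact: cst_continuous].
Qed.

Lemma continuous_enorm y : continuous (fun z : E => enorm (z - y)).
Proof.
have cj (j : 'I_d.+1) : continuous (fun z : E => (z - y) 0 j).
  rewrite (_ : (fun z => _) = (fun z : E => z 0 j) - cst (y 0 j)); last first.
    by apply/funext => z; rewrite !mxE.
  by move=> z; apply: continuousB; [exact: coord_continuous|exact: cst_continuous].
have cdot : continuous (fun z : E => dot (z - y) (z - y)).
  have := @continuous_big R _ +%R 0 xpredT (@add_continuous _) E (index_enum 'I_d.+1)
    (fun j (z : E) => (z - y) 0 j * (z - y) 0 j); apply=> j _ z.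
  by apply: continuousM; exact: cj.
by move=> z; apply: (continuous_comp (cdot z)); exact: sqrt_continuous.
Qed.

Lemma enormZ (a : R) x : 0 <= a -> enorm (a *: x) = a * enorm x.
Proof.
by move=> a0; rewrite /enorm dotZl dotZr mulrA -expr2 sqrtrM ?sqr_ge0// sqrtr_sqr ger0_norm.
Qed.

Lemma enorm0 : enorm (0 : E) = 0.
Proof. by rewrite -(scale0r (0 : E)) enormZ// mul0r. Qed.

Lemma enormN x : enorm (- x) = enorm x.
Proof. by rewrite /enorm -scaleN1r dotZl dotZr !mulN1r opprK. Qed.

(* From a boundary point, moving against the direction [e] of the epigraph leaves
   the closure of the domain. *)
Lemma interior_closure_lipschitz D : lipschitz_domain D -> (closure D)° `<=` D.
Proof.
move=> [oD _ _ _ lip] x intx; apply: contrapT => nDx.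
have bx : boundary D x.
  by split; [exact: interior_subset|rewrite ((interior_id _).1 oD)].
have [r [e [gamma [r0 e1 [M Mgamma] gammae epi]]]] := lip x bx.
have ee : dot e e = 1.
  by rewrite -[LHS]sqr_sqrtr ?dot_ge0// -/(enorm e) e1 expr1n.
have xe : dot x e <= gamma x.
  rewrite leNgt; apply/negP => /(epi x _).2; rewrite subrr enorm0 => /(_ r0).
  exact: nDx.
have cy : {for 0, continuous (fun s : R => x - s *: e)}.
  apply: cvgB; first exact: cvg_cst.
  by apply: cvgZ; [exact: cvg_id|exact: cvg_cst].
have {}cy : nbhs (0 : R) [set s | closure D (x - s *: e)].
  by apply: cy; rewrite scale0r subr0; exact: intx.
(* [s] is small enough for x - s e to stay both in the closure of [D] and in the ball where the
   epigraph description is valid. *)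
have [s [s0 sr Dy]] : exists s : R, [/\ 0 < s, s < r & closure D (x - s *: e)].
  have half (t : R) : 0 < t -> t / 2 < t by move=> t0; lra.
  have [eps /= eps0 Heps] := (nbhs_ballP _ _).1 cy.
  exists (Num.min (eps / 2) (r / 2)); split.
  - by rewrite lt_min !divr_gt0.
  - by rewrite gt_min (half r) ?orbT.
  apply: Heps; rewrite /ball/= sub0r normrN ger0_norm; last first.
    by rewrite le_min !divr_ge0// ltW.
  by rewrite gt_min half.
set y := x - s *: e in Dy.
have gy : gamma y = gamma x by rewrite /y -scaleNr gammae.
have dy : dot y e = dot x e - s by rewrite /y -scaleNr dotDl dotZl ee mulr1.
have ny : enorm (y - x) = s by rewrite /y addrC addKr enormN enormZ ?e1 ?mulr1// ltW.
have s20 : 0 < s / 2 by rewrite divr_gt0.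
have n1 : \forall z \near y, enorm (z - x) < r.
  have := @cvgr_lt _ _ (nbhs y) _ (fun z => enorm (z - x)) _ (@continuous_enorm x y) r; rewrite ny; exact.
have n2 : \forall z \near y, dot z e < dot y e + s / 2.
  by apply: (@cvgr_lt _ _ (nbhs y) _ (fun z => dot z e) _ (@continuous_dot_l e y)); rewrite ltrDl.
(* This radius keeps gamma z above gamma y - s/2; [M] has no prescribed sign, whence |M| + 1. Then
   dot z e < dot x e - s/2 <= gamma x - s/2 < gamma z, so z lies outside [D]. *)
have n3 : \forall z \near y, enorm (z - y) < s / 2 / (`|M| + 1).
  apply: (@cvgr_lt _ _ (nbhs y) _ (fun z => enorm (z - y)) _ (@continuous_enorm y y)).
  by rewrite subrr enorm0 divr_gt0// ltr_wpDl.
have [z [Dz [[z1 z2] z3]]] := Dy _ (filterI (filterI n1 n2) n3).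
have := (epi z z1).1 Dz.
have zy : gamma y - gamma z < s / 2.
  apply: (le_lt_trans (ler_norm _)); rewrite distrC.
  apply: (le_lt_trans (Mgamma z y)).
  apply: (@le_lt_trans _ _ ((`|M| + 1) * enorm (z - y))).
    apply: ler_wpM2r; first exact: sqrtr_ge0.
    by rewrite (le_trans (ler_norm _))// lerDl.
  by rewrite mulrC -ltr_pdivlMr// ltr_wpDl.
by rewrite gy in zy; rewrite dy in z2 => gz; lra.
Qed.

(** A neighborhood is the interior of a union of closed elements, so it lies in the interior of the
    closure of [D]. For a slit domain that could exceed [D]; the Lipschitz boundary excludes it. The
    inclusion is needed since [kappa] is controlled on [D] only. *)
Lemma coarse_nbhd_subset D m (TH : 'I_m -> seq E) p :
  lipschitz_domain D -> is_mesh D TH -> coarse_nbhd TH p `<=` D.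
Proof.
move=> lD [_ cD _]; apply: subset_trans (interior_closure_lipschitz lD).
apply: interiorS; rewrite cD => x [k _ kx]; by exists k.
Qed.

Lemma hull_bounded (s : seq E) : exists M : R, forall x, hull s x ->
  forall j, `|x 0 j| <= M.
Proof.
exists (\sum_k `|s`_(k : 'I_(size s))|) => x [c [c0 c1 ->]] j.
rewrite summxE (le_trans (ler_norm_sum _ _ _))//; apply: ler_sum => k _.
rewrite mxE normrM -[leRHS]mul1r ler_pM//.
  rewrite ger0_norm// -c1 (bigD1 k)//= lerDl sumr_ge0//.
rewrite -[leRHS]/(mx_norm _) mx_normrE.
exact: (le_bigmax _ (fun i => `|s`_k i.1 i.2|) (0, j)).
Qed.

(** An interior point and a small shift of it give a positive distance. Boundedness of the hull is
    essential: the supremum of an unbounded set is a default value. *)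
Lemma diam_gt0 (s : seq E) : is_element s -> 0 < diam (elt s).
Proof.
move=> [[x intx] _]; have [M HM] := hull_bounded s.
have : nbhs x (elt s) by have := @open_interior _ (hull s); rewrite openE; exact.
move=> /nbhs_ballP[r /= r0 xr].
have r20 : 0 < r / 2 by rewrite divr_gt0.
pose y := x + (r / 2) *: (delta_mx 0 0 : E).
have elty : elt s y.
  apply: xr; split=> // i j; rewrite !mxE /ball/= opprD addNKr normrN.
  rewrite normrM (gtr0_norm r20).
  apply: (@le_lt_trans _ _ (r / 2)).
    apply: ler_piMr; first exact: ltW.
    by case: (_ && _); rewrite ?normr1 ?normr0.
  by lra.
have yx : enorm (y - x) = r / 2.
  rewrite /y addrC addKr enormZ ?ltW// /enorm /dot big_ord_recl big1 => [|k _].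
    by rewrite !mxE !eqxx/= mulr1 addr0 sqrtr1 mulr1.
  by rewrite !mxE eqxx /= mul0r.
apply: (@lt_le_trans _ _ (r / 2)) => //; rewrite -yx.
apply: ub_le_sup; last by exists y => //; exists x.
exists (Num.sqrt (\sum_(j < d.+1) (M + M) ^+ 2)) => _ [u eu [w ew <-]].
rewrite ler_wsqrtr//; apply: ler_sum => j _; rewrite -expr2 !mxE.
have b t : elt s t -> `|t 0 j| <= M by move=> /interior_subset /HM.
rewrite -[leLHS]real_normK ?num_real//.
have uw : `|u 0 j - w 0 j| <= M + M by rewrite (le_trans (ler_normB _ _))// lerD ?b.
by rewrite lerXn2r// nnegrE// (le_trans _ uw).
Qed.

Lemma mesh_size_gt0 D m (TH : 'I_m -> seq E) (k : 'I_m) : is_mesh D TH ->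
  0 < mesh_size TH.
Proof.
move=> [eltT _ _]; apply: lt_le_trans (diam_gt0 (eltT k)) _.
exact: (le_bigmax _ (fun k => diam (elt (TH k)))).
Qed.

End mesh_geometry.

(** * Harmonic functions under combination and change of coefficient *)

Section harmonic_combinations.
Context {R : realType} {d : nat}.
Local Notation E := 'rV[R]_d.+1.
Local Notation leb := (@lebesgue R d).
Variables (U : set E) (kappa : E -> R) (B : R).
Hypothesis oU : open U.
Hypothesis mkappa : measurable_fun (U : set (@lebesgue_space R d)) kappa.
Hypothesis kappaB : forall x, U x -> 0 <= kappa x <= B.
Implicit Types (u v : sobfun R d).

Definition harmonic u := H1 U u /\ weakly_harmonic kappa U u.

Lemma harmonic_lin (a : R) u v : harmonic u -> harmonic v -> harmonic (a *: u + v).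
Proof.
move=> [Hu hu] [Hv hv]; split; first exact: H1_lin.
exact: (weakly_harmonic_lin oU mkappa kappaB a Hu.1 Hv.1).
Qed.

Lemma harmonic0 : harmonic (0 : sobfun R d).
Proof. by split; [exact: H1_0|exact: weakly_harmonic0]. Qed.

Lemma harmonic_sum (I : Type) (r : seq I) (P : pred I) (c : I -> R)
    (u : I -> sobfun R d) :
  (forall i, harmonic (u i)) -> harmonic (\sum_(i <- r | P i) c i *: u i).
Proof.
move=> hu; elim/big_rec: _ => [|i z _ hz]; first exact: harmonic0.
exact: harmonic_lin.
Qed.

Lemma harmonicB u v : harmonic u -> harmonic v -> harmonic (u - v).
Proof. by move=> hu hv; rewrite addrC -scaleN1r; exact: harmonic_lin. Qed.

End harmonic_combinations.

(** The two integrands differ only on the null set [A]. This carries the equation from [kappa],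
    bounded almost everywhere, to a coefficient bounded at every point. *)
Lemma weakly_harmonic_ae_eq (R : realType) (d : nat) (U A : set 'rV[R]_d.+1)
    (kappa kappa' : 'rV[R]_d.+1 -> R) (u : sobfun R d) :
  open U -> measurable (A : set (@lebesgue_space R d)) ->
  lebesgue (A : set (@lebesgue_space R d)) = 0%E ->
  measurable_fun (U : set (@lebesgue_space R d)) kappa ->
  measurable_fun (U : set (@lebesgue_space R d)) kappa' ->
  (forall x, U x -> ~ A x -> kappa x = kappa' x) ->
  finite_H1_norm U u -> weakly_harmonic kappa U u -> weakly_harmonic kappa' U u.
Proof.
move=> oU mA A0 mk mk' kk' iu hu v Hv; rewrite -(hu v Hv) /Rintegral; congr fine.
have mdot := measurable_dot iu Hv.1.
apply: ae_eq_integral.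
- exact: open_lebesgue_measurable.
- by apply/measurable_EFinP; exact: (measurable_funM mk' mdot).
- by apply/measurable_EFinP; exact: (measurable_funM mk mdot).
exists A; split=> // x /= nx; apply: contrapT => Ax; apply: nx => Ux.
by rewrite kk'.
Qed.

Theorem lemma4p9 (R : realType) (d : nat) (hd : (d.+1 <= 3)%N)
  (* domain and coefficient *)
  (D : set 'rV[R]_d.+1) (hD : lipschitz_domain D)
  (kappa : 'rV[R]_d.+1 -> R) (alpha beta : R) (halpha : 0 < alpha)
  (kappa_meas : measurable_fun (D : set (@lebesgue_space R d)) kappa)
  (kappa_bnd : {ae @lebesgue R d, forall x, D x -> alpha <= kappa x <= beta})
  (* coarse mesh with its vertices and mesh size, fine mesh *)
  (mH : nat) (TH : 'I_mH -> seq 'rV[R]_d.+1) (hTH : is_mesh D TH)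
  (N : nat) (O : 'I_N -> 'rV[R]_d.+1) (O_inj : injective O)
  (O_vertex : forall x, (exists k, O k = x) <-> mesh_vertex TH x)
  (H : R) (hH : H = mesh_size TH)
  (mh : nat) (Th : 'I_mh -> seq 'rV[R]_d.+1) (hTh : is_mesh D Th)
  (hTh_TH : refines Th TH)
  (* multiscale basis functions and standing assumptions *)
  (chi : 'I_N -> sobfun R d) (hchi : multiscale_basis kappa TH O chi)
  (C0 : R)
  (hC0 : forall k, {ae @lebesgue R d, forall x, coarse_nbhd TH (O k) x ->
                      enorm ((chi k).2 x) <= C0})
  (kt : 'rV[R]_d.+1 -> R) (hkt : kt = kappa_tilde kappa H chi)
  (hkt0 : lebesgue (D `&` [set x | kt x = 0]) = 0%E)
  (* source term and fine-scale solution *)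
  (f : 'rV[R]_d.+1 -> R) (hf : L2 D f)
  (uh : 'rV[R]_d.+1 -> R) (huh : fe_space D Th uh)
  (uh_sol : forall vh, fe_space D Th vh ->
     \int[@lebesgue R d]_(x in D) (kappa x * dot (grad uh x) (grad vh x)) =
     \int[@lebesgue R d]_(x in D) (f x * vh x))
  (* neighborhood of the vertex O i, on the boundary of which chi i vanishes *)
  (i : 'I_N) (omega : set 'rV[R]_d.+1) (homega : omega = coarse_nbhd TH (O i))
  (chi_i0 : H10 omega (chi i))
  (* fine-grid nodes on the boundary of omega and harmonic extensions *)
  (L : nat) (node : 'I_L -> 'rV[R]_d.+1) (node_inj : injective node)
  (hnode : forall x,
     (exists j, node j = x) <-> mesh_vertex Th x /\ boundary omega x)
  (delta : 'I_L -> 'rV[R]_d.+1 -> R)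
  (hdelta : forall j, boundary_pw_linear omega Th (delta j) /\
                      forall k, delta j (node k) = (j == k)%:R)
  (phi : 'I_L -> sobfun R d)
  (hphi : forall j, dirichlet_solution kappa omega (delta j) (phi j))
  (* discrete POD *)
  (lambda : 'I_L -> R) (v : 'I_L -> 'cV[R]_L)
  (hv : eigenpairs (stiffness kappa omega phi) (mass kt omega phi) lambda v)
  (* snapshot of uh and its projection *)
  (usnap : sobfun R d) (husnap : snapshot_space phi usnap)
  (usnap_bnd : boundary_value omega usnap uh)
  (n : nat) (hn : (0 < n <= L)%N)
  (un : sobfun R d)
  (hun : un = pod_projection kt omega (fun j => lin_comb phi (v j)) n usnap) :
  (\int[@lebesgue R d]_(x in omega)
      ((chi i).1 x ^+ 2 * kappa x *
       dot ((usnap - un).2 x) ((usnap - un).2 x))%:E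
   <= (4 * H ^- 2)%:E *
      \int[@lebesgue R d]_(x in omega)
        (kt x * (usnap - un).1 x ^+ 2)%:E)%E.
Proof.
have oU : open omega by rewrite homega; exact: open_interior.
have mU := open_lebesgue_measurable oU.
have oD : open D by case: hD.
have UD : omega `<=` D by rewrite homega; exact: coarse_nbhd_subset.
have [A [mA A0 HA]] := kappa_bnd.
have mk : measurable_fun (omega : set (@lebesgue_space R d)) kappa.
  exact: (measurable_funS (open_lebesgue_measurable oD) UD kappa_meas).
(* The bounds on [kappa] hold almost everywhere only; clamping makes them hold
   everywhere. *)
pose kap x := Num.max alpha (Num.min beta (kappa x)).
have mkap : measurable_fun (omega : set (@lebesgue_space R d)) kap.
  apply: measurable_maxr; first exact: measurable_cst.
  by apply: measurable_minr; [exact: measurable_cst|exact: mk].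
have kapE x : omega x -> ~ A x -> kappa x = kap x.
  move=> /UD Dx Ax; have /andP[ak kb] : alpha <= kappa x <= beta.
    by apply: contrapT => nk; apply: Ax; apply: HA => /(_ Dx).
  by rewrite /kap (min_idPr kb) (max_idPr ak).
have kapB x : omega x -> 0 <= kap x <= Num.max alpha beta.
  move=> _; rewrite le_max (ltW halpha)/= ge_max le_max lexx/=.
  by rewrite le_max !ge_min lexx !orbT.
have hw : harmonic omega kap (usnap - un).
  have hphik k : harmonic omega kap (phi k).
    have [Hk hk _] := hphi k; split => //.
    exact: (weakly_harmonic_ae_eq oU mA A0 mk mkap kapE Hk.1 hk).
  have hcomb c : harmonic omega kap (lin_comb phi c).
    exact: (harmonic_sum oU mkap kapB).
  have [c _ <-] := husnap; rewrite hun.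
  apply: (harmonicB oU mkap kapB); first exact: hcomb.
  by apply: (harmonic_sum oU mkap kapB) => j; exact: hcomb.
set w := usnap - un in hw *; have [Hw hw'] := hw.
have [ichi _] := chi_i0; have [iw _] := Hw.
have [[mchi _] _] := ichi; have [[mw _] _] := iw.
have -> : (\int[@lebesgue R d]_(x in omega)
      ((chi i).1 x ^+ 2 * kappa x * dot (w.2 x) (w.2 x))%:E =
    \int[@lebesgue R d]_(x in omega)
      ((chi i).1 x ^+ 2 * kap x * dot (w.2 x) (w.2 x))%:E)%E.
  have mchi2 : measurable_fun (omega : set (@lebesgue_space R d))
    (fun x => (chi i).1 x ^+ 2) by exact: measurable_funX.
  have mdot := measurable_dot iw iw.
  apply: ae_eq_integral; first exact: mU.
  - by apply/measurable_EFinP; exact: (measurable_funM (measurable_funM mchi2 mk) mdot).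
  - by apply/measurable_EFinP; exact: (measurable_funM (measurable_funM mchi2 mkap) mdot).
  exists A; split=> // x /= nx; apply: contrapT => Ax; apply: nx => Ux.
  by rewrite kapE.
apply: (le_trans (caccioppoli oU mkap kapB chi_i0 Hw hw')).
pose e2 x := kap x * dot ((chi i).2 x) ((chi i).2 x) * w.1 x ^+ 2.
have me2 : measurable_fun (omega : set (@lebesgue_space R d)) e2.
  apply: (measurable_funM (measurable_funM mkap (measurable_dot ichi ichi))).
  exact: measurable_funX.
have e20 x : omega x -> 0 <= e2 x.
  move=> Ux; have /andP[k0 _] := kapB _ Ux.
  by rewrite mulr_ge0 ?sqr_ge0// mulr_ge0// dot_ge0.
(* The vertex [O i] belongs to some element, so the mesh is not empty. Positivity is what allows
   H^-2 and H^2 to cancel: the inverse of 0 is 0. *)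
have H0 : 0 < H.
  by have [k _] := (O_vertex (O i)).1 (ex_intro _ i erefl); rewrite hH; exact: mesh_size_gt0 k hTH.
(* Off [A], keep only the [i]-th of the nonnegative terms in the sum defining [kt]. Measurability is
   used for [e2] alone. *)
have ktle : ((H ^+ 2)%:E * \int[@lebesgue R d]_(x in omega) (e2 x)%:E <=
    \int[@lebesgue R d]_(x in omega) (kt x * w.1 x ^+ 2)%:E)%E.
  have me2' := (measurable_EFinP _ _).2 me2.
  have e20' x : omega x -> (0 <= (e2 x)%:E)%E by move=> Ux; rewrite lee_fin e20.
  rewrite -(ge0_integralZl_EFin (@lebesgue R d) mU e20' me2' (sqr_ge0 H)).
  apply: (ae_le_integral_nonmeasurable mU mA A0) => [|x Ux|x Ux Ax].
  - exact: measurable_funeM.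
  - by rewrite lee_fin mulr_ge0 ?sqr_ge0 ?e20.
  rewrite lee_fin /e2 (mulrA (H ^+ 2)) (mulrA (H ^+ 2) (kap x)).
  apply: ler_wpM2r; first exact: sqr_ge0.
  rewrite hkt /kappa_tilde (kapE _ Ux Ax); apply: ler_wpM2l.
    by have /andP[k0 _] := kapB _ Ux; rewrite mulr_ge0 ?sqr_ge0.
  by rewrite (bigD1 i)//= lerDl sumr_ge0// => k _; exact: dot_ge0.
have c0 : (0 <= (4 * H ^- 2)%:E :> \bar R)%E.
  by rewrite lee_fin mulr_ge0// invr_ge0 sqr_ge0.
apply: le_trans (lee_wpmul2l c0 ktle).
by rewrite muleA -EFinM -mulrA mulVf ?mulr1// expf_neq0// gt_eqF.
Qed.
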